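(* For any knot $\mathcal{K}$, any positive integer $N$ and any $i\in\mathbb{Z}$, $$J_{N}\bigl(\mathcal{K};e^{\frac{\pi i\sqrt{-1}}{N}}\bigr)=1,\qquad J_{N}\bigl(\mathcal{K};e^{\frac{\pi i\sqrt{-1}}{N+2}}\bigr)=1.$$
   Context: For a knot $\mathcal{K}$ in $S^3$, $J_N(\mathcal{K};q)\in\mathbb{Z}[q,q^{-1}]$ is the normalized ($0$-framed) colored Jones polynomial of $\mathcal{K}$ colored by the $(N+1)$-dimensional irreducible representation $\mathrm{Sym}^N(V)$ of $U_q(sl_2)$, with $J_N(U;q)=1$ for the unknot $U$ and $J_0=1$. Normalization of $q$: $J_1$ extends to links with $q^{2}J_1(\mathcal{L}_+;q)-q^{-2}J_1(\mathcal{L}_-;q)=(q-q^{-1})J_1(\mathcal{L}_0;q)$ (so $J_1(\mathcal{K};q)=V(\mathcal{K};q^{-2})$ for knots, where $V$ is the Jones polynomial normalized by $q^{-1}V(\mathcal{L}_+)-qV(\mathcal{L}_-)=(q^{1/2}-q^{-1/2})V(\mathcal{L}_0)$). Equivalently, $J_N(\mathcal{K};q)=W_{(N)}(\mathcal{K};q,q^2)/W_{(N)}(U;q,q^2)$, where $W_{(N)}(\mathcal{K};q,t)$ is the colored HOMFLY-PT invariant colored by the one-row partition $(N)$. Here $i$ is an integer (not the imaginary unit). *)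

(* Defs.v *)
From HB Require Import structures.
From mathcomp Require Import all_boot all_order all_algebra.
From mathcomp Require Import complex.
From mathcomp Require Import all_classical all_reals all_analysis.

Set Implicit Arguments.
Unset Strict Implicit.
Unset Printing Implicit Defensive.

Import Order.TTheory GRing.Theory Num.Theory.
Local Open Scope ring_scope.

(** * Oriented knot diagrams

   A diagram in general position with respect to a height function is read
   from bottom to top as a word of elementary layers, each acting on the strands
   at positions [i] and [i.+1] (counted from the left, starting at 0).  A
   horizontal level is described by the list of orientations of the strands
   that meet it: [true] is upward, [false] is downward.

   These are the usual generators of the category of oriented tangles: it is
   enough to have crossings of two upward strands, since any crossing can be
   rotated to that position by a planar isotopy. *)
Inductive layer : Type :=
| Cross of bool & nat (* a crossing of two upward strands; [true] = positive *)
| Cup of bool & nat   (* a local minimum; creates orientations [b; ~~ b] *)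
| Cap of bool & nat.  (* a local maximum; absorbs orientations [b; ~~ b] *)

Definition diagram := seq layer.

Definition layer_orientations (x : layer) (o : seq bool) : option (seq bool) :=
  match x with
  | Cross _ i =>
      if take 2%N (drop i o) == [:: true; true] then Some o else None
  | Cup b i =>
      if (i <= size o)%N then Some (take i o ++ [:: b; ~~ b] ++ drop i o)
      else None
  | Cap b i =>
      if take 2%N (drop i o) == [:: b; ~~ b] then Some (take i o ++ drop i.+2 o)
      else None
  end.

Fixpoint orientations (D : diagram) (o : seq bool) : option (seq bool) :=
  if D is x :: D' then obind (orientations D') (layer_orientations x o)
  else Some o.

(* The diagram is composable and has neither bottom nor top end points. *)
Definition is_link_diagram (D : diagram) : bool :=
  orientations D [::] == Some [::].

(* The number of link components which are completed by [D], where [l] labels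
   the strands entering [D] from below: two strands carry the same label when
   they are already joined below.  A cup gets a fresh label; a cap either
   merges two labels or closes a component. *)
Fixpoint components (D : diagram) (l : seq nat) : nat :=
  match D with
  | [::] => 0%N
  | Cross _ i :: D' =>
      if drop i l is a :: b :: r then components D' (take i l ++ b :: a :: r)
      else 0%N
  | Cup _ i :: D' =>
      let f := (foldr maxn 0%N l).+1 in
      components D' (take i l ++ f :: f :: drop i l)
  | Cap _ i :: D' =>
      if drop i l is a :: b :: r then
        let l' := take i l ++ r in
        if a == b then (components D' l').+1
        else components D' [seq (if c == b then a else c) | c <- l']
      else 0%N
  end.

Definition is_knot_diagram (D : diagram) : bool :=
  is_link_diagram D && (components D [::] == 1%N).

Record knot : Type := Knot {
  knot_word :> diagram;
  knot_wordP : is_knot_diagram knot_word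
}.

(** * The representation [Sym^N V] of U_q(sl_2), for generic q *)

(* The field of rational functions in q; Z[q, q^-1] is a subring of it. *)
Notation Qq := {fraction {poly int}}.

Definition q : Qq := tofrac ('X : {poly int}).

Definition qint (n : nat) : Qq := (q ^+ n - q ^- n) / (q - q^-1).

Definition qfact (n : nat) : Qq := \prod_(1 <= k < n.+1) qint k.

(* Weight of the basis vector v_a, i.e., K v_a = q ^ (wt N a) v_a. *)
Definition wt (N a : nat) : int := N%:Z - (2 * a)%N%:Z.

(* E v_a = [N - a + 1] v_(a-1) and F v_a = [a + 1] v_(a+1); column a is the
   image of v_a. *)
Definition Emx (N : nat) : 'M[Qq]_N.+1 :=
  \matrix_(c, a) if c.+1 == a :> nat then qint (N - a).+1 else 0.

Definition Fmx (N : nat) : 'M[Qq]_N.+1 :=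
  \matrix_(c, a) if c == a.+1 :> nat then qint a.+1 else 0.

(** * The Reshetikhin-Turaev state sum *)

(* With Delta(E) = E (x) K + 1 (x) E and Delta(F) = F (x) 1 + K^-1 (x) F, the
   universal R-matrix acts by
     R    = q^(H(x)H/2) sum_m  (q - q^-1)^m q^( m(m-1)/2)/[m]! E^m (x) F^m,
     R^-1 = sum_m (q^-1 - q)^m q^(-m(m-1)/2)/[m]! E^m (x) F^m q^(-H(x)H/2).
   A crossing of framed strands acts by P R (positive) or R^-1 P (negative),
   where P is the flip; a positive curl contributes the twist
   theta = q^((N^2 + 2N)/2).  To obtain the 0-framed invariant, each crossing is
   multiplied here by theta^-1 (positive) or theta (negative), so that a diagram
   is corrected by theta^(-writhe).  Both q^(H(x)H/2) and theta may involve q^(1/2),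
   but on v_a (x) v_b
     q^(H(x)H/2) theta^-1 = q^((N-2a)(N-2b)/2 - (N^2+2N)/2)
                          = q^(2ab - N(a+b+1)). *)
Definition framed_exp (N a b : nat) : int :=
  (2 * a * b)%N%:Z - (N * (a + b + 1))%N%:Z.

(* The coefficient of v_c (x) v_d in the image of v_a (x) v_b. *)
Definition crossing (N : nat) (positive : bool) (a b c d : 'I_N.+1) : Qq :=
  if positive then
    q ^ (framed_exp N c d) *
    \sum_(m < N.+1) (q - q^-1) ^+ m * q ^+ 'C(m, 2) / qfact m
                    * (Emx N ^+ m) d a * (Fmx N ^+ m) c b
  else
    q ^ (- framed_exp N a b) *
    \sum_(m < N.+1) (q^-1 - q) ^+ m * q ^- 'C(m, 2) / qfact m
                    * (Emx N ^+ m) c b * (Fmx N ^+ m) d a.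

(* Upward strands carry V = Sym^N, downward ones its dual V^*.  Cups and caps
   are (co)evaluations, twisted by the pivotal element K as follows:
     1 -> V (x) V^*,  1 |-> sum_a v_a (x) v^a;
     1 -> V^* (x) V,  1 |-> sum_a v^a (x) K^-1 v_a;
     V^* (x) V -> 1,  f (x) v |-> f(v);
     V (x) V^* -> 1,  v (x) f |-> f(K v). *)
Definition cup_weight (N : nat) (b : bool) (a : 'I_N.+1) : Qq :=
  if b then 1 else q ^ (- wt N a).

Definition cap_weight (N : nat) (b : bool) (a : 'I_N.+1) : Qq :=
  if b then q ^ (wt N a) else 1.

(* Applied to a diagram without top end points, the value of the corresponding
   linear form on the basis tensor given by the list of indices [s]. *)
Fixpoint state_sum (N : nat) (D : diagram) (s : seq 'I_N.+1) : Qq :=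
  match D with
  | [::] => (nilp s)%:R
  | Cross p i :: D' =>
      if drop i s is a :: b :: r then
        \sum_(c < N.+1) \sum_(d < N.+1)
           crossing p a b c d * state_sum D' (take i s ++ c :: d :: r)
      else 0
  | Cup b i :: D' =>
      \sum_(a < N.+1)
         cup_weight b a * state_sum D' (take i s ++ a :: a :: drop i s)
  | Cap b i :: D' =>
      if drop i s is a :: a' :: r then
        if a == a' then cap_weight b a * state_sum D' (take i s ++ r) else 0
      else 0
  end.

(* The invariant of the unknot is the quantum dimension [N + 1]. *)
Definition colored_jones (N : nat) (K : knot) : Qq :=
  @state_sum N K [::] / qint N.+1.

(** * Values of Laurent polynomials at complex numbers *)

Definition laurent_value (R : realType) (f : Qq) (z v : R[i]) : Prop :=
  exists (p : {poly int}) (m : nat),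
    f = tofrac p / q ^+ m /\ v = (map_poly intr p).[z] / z ^+ m.

(* The value f(z), for z != 0 and f in Z[q, q^-1] (in which case the v such that
   [laurent_value f z v] is unique); the junk value is 0 for f not in
   Z[q, q^-1]. *)
Definition laurent_eval (R : realType) (f : Qq) (z : R[i]) : R[i] :=
  xget 0 [set v | laurent_value f z v]%classic.

(* e ^ (t sqrt(-1)) *)
Definition expi (R : realType) (t : R) : R[i] := Complex (cos t) (sin t).

(* Main.v *)
Require Import Defs.
From mathcomp Require Import all_boot all_order all_algebra.
From mathcomp Require Import complex.
From mathcomp Require Import all_classical all_reals all_analysis.
From mathcomp Require Import zify ring.
Local Open Scope ring_scope.

Set Implicit Arguments.
Unset Strict Implicit.
Unset Printing Implicit Defensive.

Import Order.TTheory GRing.Theory Num.Theory.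

(** The value of the colored Jones polynomial of a knot [K] is read off the
   diagram [D] obtained by removing the last cap of [K].  The state sum of [D]
   is an invariant vector of [V (x) V^*] or [V^* (x) V], where [V = Sym^N], and
   such vectors form a line: all the diagonal coefficients of this vector are,
   up to the pivotal factor, the same scalar, and this scalar is [J_N(K)] because
   the closing cap contributes the quantum dimension [N + 1].  Equality of the
   diagonal coefficients already follows from invariance under the raising
   operator E ([open_valueS], [colored_jones_open]).  Consequently [J_N(K)] is a
   Laurent polynomial, and its value at [z <> 0] is [open_value z b D a], for
   whichever index [a] one likes at the cut ([laurent_eval_open]).

   Follow the strand of the knot from the cut.  Call a set P of indices closed
   when a nonzero crossing weight carries a strand with index in P to the same
   strand with index in P, i.e., when the vectors [v_a], [a] in P, span a
   subspace preserved by the R-matrices.  Since the cut knot is a single strand,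
   a state with nonzero weight whose cut index is in P (resp. outside P) has all
   its indices in P (resp. outside P): this is [amplitude_transfer], the
   heart of the proof.  The state sum thus collapses to the one of a
   sub- or quotient representation.

   If [z^(2N) = 1], the coefficient [bracket z N] of [v_0] in the image of [v_1]
   under (q - 1/q) E vanishes, so the nonzero indices form a closed set and only
   [v_0] remains; every crossing and every nontrivial cup or cap acts on it by
   the sign [z^N] ([open_value_top]).

   If [z^(2(N+2)) = 1], let [l] be the order of [z^2].  When [l <= N + 1], the
   brackets of [N + 2 - l] and of [l] vanish, so that every term of the R-matrix
   except the first one kills [v_(l-1)], which spans a line where everything acts
   by the sign [z^(N+2)] ([open_value_mid]).  When [l = N + 2], the vectors
   [v_1, ..., v_(N+1)] of [Sym^(N+2)] span a copy of [Sym^N], so the values for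
   [N] and for [N + 2] coincide ([open_value_linkage]) and the latter is known from
   the first case.

   There remains a power of a sign, whose exponent depends on the diagram only.
   It is even: for [N = 2] and [z = i] both cases apply, to the cut indices 0 and 1;
   the first gives the value of the power for the sign [-1], the second for the
   sign [1] ([line_value_sign]).  This replaces a count of crossings
   and turning points of the diagram. *)

(** * Layers of a diagram *)

(** Positions in a diagram are numbers; here they become splittings of the
   list of strands, which is the form used in every induction on diagrams. *)
Inductive layer_step : layer -> seq bool -> seq bool -> Prop :=
| CrossStep p o1 o2 :
    layer_step (Cross p (size o1)) (o1 ++ true :: true :: o2)
      (o1 ++ true :: true :: o2)
| CupStep b o1 o2 :
    layer_step (Cup b (size o1)) (o1 ++ o2) (o1 ++ b :: ~~ b :: o2)
| CapStep b o1 o2 :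
    layer_step (Cap b (size o1)) (o1 ++ b :: ~~ b :: o2) (o1 ++ o2).

Lemma take2_drop (T : eqType) (i : nat) (o : seq T) (u v : T) :
  take 2 (drop i o) == [:: u; v] ->
  exists o1 o2, [/\ size o1 = i, o = o1 ++ u :: v :: o2 & drop i.+2 o = o2].
Proof.
move=> /eqP E; exists (take i o), (drop i.+2 o).
have lt_i : (i < size o)%N.
  rewrite ltnNge; apply/negP => le_o; move: E.
  by rewrite drop_oversize.
split=> //; first by rewrite size_takel // ltnW.
rewrite -[LHS](cat_take_drop i); congr (_ ++ _).
by rewrite -[LHS](cat_take_drop 2) E drop_drop add2n.
Qed.

Lemma layer_stepP x o o' : layer_orientations x o = Some o' -> layer_step x o o'.
Proof.
case: x => [p i|b i|b i] /=.
- case: ifP => // /take2_drop[ o1 [ o2 [<- -> _]]] [<-]; exact: CrossStep.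
- case: ifP => // le_i [<-].
  have := CupStep b (take i o) (drop i o).
  by rewrite cat_take_drop size_takel.
- case: ifP => // /take2_drop[ o1 [ o2 [<- -> ->]]] [<-].
  rewrite take_size_cat //; exact: CapStep.
Qed.

Lemma orientations_cons x D o o' : orientations (x :: D) o = Some o' ->
  exists2 o1, layer_step x o o1 & orientations D o1 = Some o'.
Proof.
by rewrite /=; case E: layer_orientations => [ o1|] //= <-; exists o1 => //; exact: layer_stepP.
Qed.

Lemma split_cat (A B : Type) (s : seq A) (o1 o2 : seq B) :
  size s = size (o1 ++ o2) ->
  exists s1 s2, [/\ s = s1 ++ s2, size s1 = size o1 & size s2 = size o2].
Proof.
rewrite size_cat => E; exists (take (size o1) s), (drop (size o1) s).
by rewrite cat_take_drop size_drop size_takel E ?leq_addr // addKn.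
Qed.

Lemma split_cat2 (A B : Type) (s : seq A) (o1 o2 : seq B) u v :
  size s = size (o1 ++ u :: v :: o2) ->
  exists s1 a b s2,
    [/\ s = s1 ++ a :: b :: s2, size s1 = size o1 & size s2 = size o2].
Proof.
case/split_cat => s1 [[|a [|b s2]] [-> E1 //= [E2]]].
by exists s1, a, b, s2.
Qed.

(** * State sums with arbitrary weights *)

(** The index set and the field vary: the same diagram is evaluated with the
   weights of [Sym^N] for several [N], at generic q and at roots of unity, and with
   the weights of one-dimensional quotients. *)
Record weights (F : fieldType) (I : finType) := Weights {
  wcross : bool -> I -> I -> I -> I -> F;
  wcup : bool -> I -> F;
  wcap : bool -> I -> F }.

Section StateSums.
Variables (F : fieldType) (I : finType) (w : weights F I).
Implicit Types (f g : seq I -> F) (s : seq I) (D : diagram).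

(** A layer acts on linear forms on tensors, by composition; a linear form is
   given by its values on the basis tensors. *)
Definition layer_op (x : layer) f s : F :=
  match x with
  | Cross p i =>
      if drop i s is a :: b :: r then
        \sum_c \sum_d wcross w p a b c d * f (take i s ++ c :: d :: r)
      else 0
  | Cup b i => \sum_a wcup w b a * f (take i s ++ a :: a :: drop i s)
  | Cap b i =>
      if drop i s is a :: a' :: r then
        if a == a' then wcap w b a * f (take i s ++ r) else 0
      else 0
  end.

Definition amplitude D f : seq I -> F := foldr layer_op f D.

Lemma layer_op_cross p i f s1 a b s2 : size s1 = i ->
  layer_op (Cross p i) f (s1 ++ a :: b :: s2) =
  \sum_c \sum_d wcross w p a b c d * f (s1 ++ c :: d :: s2).
Proof. by move=> <-; rewrite /layer_op drop_size_cat // take_size_cat. Qed.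

Lemma layer_op_cup b i f s1 s2 : size s1 = i ->
  layer_op (Cup b i) f (s1 ++ s2) =
  \sum_a wcup w b a * f (s1 ++ a :: a :: s2).
Proof. by move=> <-; rewrite /layer_op drop_size_cat // take_size_cat. Qed.

Lemma layer_op_cap b i f s1 a a' s2 : size s1 = i ->
  layer_op (Cap b i) f (s1 ++ a :: a' :: s2) =
  if a == a' then wcap w b a * f (s1 ++ s2) else 0.
Proof. by move=> <-; rewrite /layer_op drop_size_cat // take_size_cat. Qed.

(** Only the values on tensors with as many factors as the level has strands
   matter, so linear forms may be compared on lists of one length. *)
Lemma eq_layer_op x o o' f g s : layer_step x o o' -> size s = size o ->
    (forall t, size t = size o' -> f t = g t) ->
  layer_op x f s = layer_op x g s.
Proof.
case=> [p|b|b] o1 o2.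
- move=> Es fg; have [s1 [a [b [s2 [-> E1 E2]]]]] := split_cat2 Es.
  rewrite !layer_op_cross //.
  apply: eq_bigr => c _; apply: eq_bigr => d _; rewrite fg //.
  by rewrite !size_cat /= E1 E2.
- move=> Es fg; have [s1 [s2 [-> E1 E2]]] := split_cat Es.
  rewrite !layer_op_cup //.
  by apply: eq_bigr => a _; rewrite fg // !size_cat /= E1 E2.
- move=> Es fg; have [s1 [a [b' [s2 [-> E1 E2]]]]] := split_cat2 Es.
  rewrite !layer_op_cap //.
  by case: ifP => // _; rewrite fg // !size_cat /= E1 E2.
Qed.

Lemma eq_amplitude D o o' f g s : orientations D o = Some o' ->
    size s = size o -> (forall t, size t = size o' -> f t = g t) ->
  amplitude D f s = amplitude D g s.
Proof.
elim: D o s => [|x D IH] o s; first by move=> [<-] Es; apply.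
case/orientations_cons => o1 stepx Do Es fg /=.
by apply: eq_layer_op stepx Es _ => t Et; apply: IH Do Et fg.
Qed.

Lemma layer_op_lin x (J : finType) (c : J -> F) (f : J -> seq I -> F) s :
  layer_op x (fun t => \sum_j c j * f j t) s = \sum_j c j * layer_op x (f j) s.
Proof.
rewrite /layer_op; case: x => [p i|b i|b i].
- case: (drop i s) => [|a [|b r]]; try by rewrite big1 // => j _; rewrite mulr0.
  rewrite [RHS](eq_bigr (fun j => \sum_c0 \sum_d c j *
    (wcross w p a b c0 d * f j (take i s ++ c0 :: d :: r)))); last first.
    by move=> j _; rewrite mulr_sumr; apply: eq_bigr => ? _; rewrite mulr_sumr.
  rewrite [RHS]exchange_big; apply: eq_bigr => c0 _.
  rewrite [RHS]exchange_big; apply: eq_bigr => d _.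
  by rewrite mulr_sumr; apply: eq_bigr => j _; rewrite mulrCA.
- rewrite [RHS](eq_bigr (fun j => \sum_a c j *
    (wcup w b a * f j (take i s ++ a :: a :: drop i s)))); last first.
    by move=> j _; rewrite mulr_sumr.
  rewrite [RHS]exchange_big; apply: eq_bigr => a _.
  by rewrite mulr_sumr; apply: eq_bigr => j _; rewrite mulrCA.
- case: (drop i s) => [|a [|b' r]]; try by rewrite big1 // => j _; rewrite mulr0.
  case: ifP => _; last by rewrite big1 // => j _; rewrite mulr0.
  by rewrite mulr_sumr; apply: eq_bigr => j _; rewrite mulrCA.
Qed.

Lemma amplitude_lin D (J : finType) (c : J -> F) (f : J -> seq I -> F) s :
  amplitude D (fun t => \sum_j c j * f j t) s = \sum_j c j * amplitude D (f j) s.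
Proof.
rewrite /amplitude.
elim: D s => [|x D IH] s //=; rewrite -layer_op_lin.
by congr layer_op; apply: funext => t; rewrite IH.
Qed.

Definition indicator (s t : seq I) : F := (t == s)%:R.

End StateSums.
Arguments layer_op : simpl never.

(** The quantum integers are used without their common denominator q - 1/q, so
   that they make sense, and may vanish, at every nonzero point of a field. *)
Definition bracket (F : fieldType) (x : F) (n : nat) : F := x ^+ n - x ^- n.

(** * Invariance under the raising operator *)

Section Invariance.
Variables (F : fieldType) (x : F) (N : nat) (w : weights F 'I_N.+1).
Notation I := 'I_N.+1.
Implicit Types (f g : seq I -> F) (s : seq I) (D : diagram) (o : seq bool).
Hypothesis x_neq0 : x != 0.

Definition strand_wt (b : bool) (a : I) : int := if b then wt N a else - wt N a.

Fixpoint total_wt o s : int :=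
  if o is b :: o' then
    if s is a :: s' then strand_wt b a + total_wt o' s' else 0
  else 0.

(** Matrix of (q - 1/q) E on [V] for an upward strand, and of its antipode
   -(q - 1/q) E K^-1 on the dual basis for a downward one. *)
Definition raise (b : bool) (a c : I) : F :=
  if b then if a == c.+1 :> nat then bracket x (N - c) else 0
  else if c == a.+1 :> nat then - (x ^ (- wt N c) * bracket x (N - a)) else 0.

(** The linear form [f] precomposed with the action of E on a tensor product,
   given by the iterated coproduct E (x) K + 1 (x) E. *)
Fixpoint raise_form o f s : F :=
  if o is b :: o' then
    if s is a :: s' then
      x ^ total_wt o' s' * (\sum_c raise b a c * f (c :: s'))
      + raise_form o' (fun t => f (a :: t)) s'
    else 0
  else 0.

(** The case of two strands, where the compatibility of each elementary layer
   with E can be stated locally. *)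
Definition raise2 (u v : bool) (h : I -> I -> F) (a b : I) : F :=
  x ^ strand_wt v b * (\sum_c raise u a c * h c b) + \sum_c raise v b c * h a c.

Lemma total_wt_cat o1 o2 s1 s2 : size s1 = size o1 ->
  total_wt (o1 ++ o2) (s1 ++ s2) = total_wt o1 s1 + total_wt o2 s2.
Proof.
elim: o1 s1 => [|b o1 IH] [|a s1] //= => [_|[E]]; first by rewrite add0r.
by rewrite IH // addrA.
Qed.

Lemma raise_form_cat o1 o2 f s1 s2 : size s1 = size o1 ->
  raise_form (o1 ++ o2) f (s1 ++ s2) =
  x ^ total_wt o2 s2 * raise_form o1 (fun t => f (t ++ s2)) s1
  + raise_form o2 (fun t => f (s1 ++ t)) s2.
Proof.
elim: o1 s1 f => [|b o1 IH] [|a s1] f //= => [_|[E]].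
  by rewrite mulr0 add0r.
rewrite IH // total_wt_cat // expfzDr // mulrDr !addrA.
by congr (_ + _ + _); rewrite [x ^ total_wt o1 _ * _]mulrC !mulrA.
Qed.

Lemma raise_form_cat2 o1 o2 u v f s1 s2 a b : size s1 = size o1 ->
  raise_form (o1 ++ u :: v :: o2) f (s1 ++ a :: b :: s2) =
  x ^ (strand_wt u a + (strand_wt v b + total_wt o2 s2))
    * raise_form o1 (fun t => f (t ++ a :: b :: s2)) s1
  + (x ^ total_wt o2 s2 * raise2 u v (fun c d => f (s1 ++ c :: d :: s2)) a b
     + raise_form o2 (fun t => f (s1 ++ a :: b :: t)) s2).
Proof.
move=> E; rewrite raise_form_cat //=; congr (_ + _).
rewrite addrA; congr (_ + _); rewrite /raise2 mulrDr; congr (_ + _).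
by rewrite mulrA -expfzDr // [in RHS]addrC.
Qed.

Lemma raise_form_sum o (J : finType) (f : J -> seq I -> F) s :
  raise_form o (fun t => \sum_j f j t) s = \sum_j raise_form o (f j) s.
Proof.
elim: o s f => [|b o IH] [|a s] f /=; try by rewrite big1.
rewrite IH big_split -mulr_sumr exchange_big; congr (_ * _ + _) => /=.
by apply: eq_bigr => d _; rewrite mulr_sumr.
Qed.

Lemma raise_form0 o s : raise_form o (fun=> 0) s = 0.
Proof.
elim: o s => [|b o IH] [|a s] //=; rewrite IH addr0 big1 ?mulr0 // => c _.
by rewrite mulr0.
Qed.

Lemma raise_formZ o c f s :
  raise_form o (fun t => c * f t) s = c * raise_form o f s.
Proof.
elim: o s f => [|b o IH] [|a s] f /=; rewrite ?mulr0 // IH mulrDr.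
congr (_ + _); rewrite [RHS]mulrCA; congr (_ * _).
by rewrite mulr_sumr; apply: eq_bigr => d _; rewrite mulrCA.
Qed.

Lemma eq_raise_form o f g s : size s = size o ->
  (forall t, size t = size o -> f t = g t) -> raise_form o f s = raise_form o g s.
Proof.
elim: o s f g => [|b o IH] [|a s] f g //= [E] fg; congr (_ * _ + _).
  by apply: eq_bigr => c _; rewrite fg //= E.
by apply: IH => // t Et; rewrite fg //= Et.
Qed.

Hypothesis cross_wt : forall p a b c d,
  wcross w p a b c d != 0 -> wt N a + wt N b = wt N c + wt N d.
Hypothesis cross_raise : forall p h a b,
  \sum_c \sum_d wcross w p a b c d * raise2 true true h c d =
  raise2 true true (fun a b => \sum_c \sum_d wcross w p a b c d * h c d) a b.
Hypothesis cup_raise : forall b h, \sum_a wcup w b a * raise2 b (~~ b) h a a = 0.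
Hypothesis cap_raise : forall b k a a',
  raise2 b (~~ b) (fun c c' => if c == c' then wcap w b c * k else 0) a a' = 0.

Lemma strand_wtN b a : strand_wt b a + strand_wt (~~ b) a = 0.
Proof. by case: b; rewrite /= ?subrr ?addNr. Qed.

(** With the coproduct of E split at the layer, the terms in which E acts to
   the left or to the right match because the layer preserves weights, and the
   middle term is the local compatibility. *)
Lemma layer_op_raise l o o' f s : layer_step l o o' -> size s = size o ->
  layer_op w l (raise_form o' f) s = raise_form o (layer_op w l f) s.
Proof.
case=> [p|b|b] o1 o2 Es.
- have [s1 [a [b [s2 [-> E1 E2]]]]] := split_cat2 Es.
  rewrite layer_op_cross // raise_form_cat2 //.
  under eq_bigr => c _ do under eq_bigr => d _ do
    rewrite raise_form_cat2 // 2!mulrDr.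
  under eq_bigr => c _ do rewrite 2!big_split.
  rewrite 2!big_split; congr (_ + (_ + _)) => /=.
  + rewrite [in RHS](@eq_raise_form _ _
     (fun t => \sum_c \sum_d wcross w p a b c d * f (t ++ c :: d :: s2))) //;
      last by move=> t Et; rewrite layer_op_cross // Et.
    rewrite raise_form_sum mulr_sumr; apply: eq_bigr => c _.
    rewrite raise_form_sum mulr_sumr; apply: eq_bigr => d _.
    rewrite raise_formZ [RHS]mulrCA.
    have [->|/cross_wt E] := eqVneq (wcross w p a b c d) 0; first by rewrite !mul0r.
    by rewrite /strand_wt (addrA (wt N a)) (addrA (wt N c)) E.
  + under eq_bigr => c _ do under eq_bigr => d _ do rewrite mulrCA.
    under eq_bigr => c _ do rewrite -mulr_sumr.
    rewrite -mulr_sumr cross_raise; congr (_ * raise2 _ _ _ _ _).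
    by apply/funext => c; apply/funext => d; rewrite layer_op_cross.
  + rewrite [in RHS](@eq_raise_form _ _
     (fun t => \sum_c \sum_d wcross w p a b c d * f (s1 ++ c :: d :: t))) //;
      last by move=> t Et; rewrite layer_op_cross.
    rewrite raise_form_sum; apply: eq_bigr => c _.
    rewrite raise_form_sum; apply: eq_bigr => d _.
    by rewrite raise_formZ.
- have [s1 [s2 [-> E1 E2]]] := split_cat Es.
  rewrite layer_op_cup // raise_form_cat //.
  under eq_bigr => a _ do
    rewrite raise_form_cat2 // (addrA (strand_wt b a)) strand_wtN add0r 2!mulrDr.
  rewrite 2!big_split /=.
  have -> : \sum_a wcup w b a * (x ^ total_wt o2 s2 *
      raise2 b (~~ b) (fun c d => f (s1 ++ c :: d :: s2)) a a) = 0.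
    under eq_bigr => a _ do rewrite mulrCA.
    by rewrite -mulr_sumr cup_raise mulr0.
  rewrite add0r; congr (_ + _).
  + rewrite [in RHS](@eq_raise_form _ _
     (fun t => \sum_a wcup w b a * f (t ++ a :: a :: s2))) //;
      last by move=> t Et; rewrite layer_op_cup // Et.
    rewrite raise_form_sum mulr_sumr; apply: eq_bigr => a _.
    by rewrite raise_formZ mulrCA.
  + rewrite [in RHS](@eq_raise_form _ _
     (fun t => \sum_a wcup w b a * f (s1 ++ a :: a :: t))) //;
      last by move=> t Et; rewrite layer_op_cup.
    rewrite raise_form_sum; apply: eq_bigr => a _.
    by rewrite raise_formZ.
- have [s1 [a [a' [s2 [-> E1 E2]]]]] := split_cat2 Es.
  rewrite layer_op_cap // raise_form_cat2 // raise_form_cat //.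
  have -> : (fun c d => layer_op w (Cap b (size o1)) f (s1 ++ c :: d :: s2)) =
      (fun c c' => if c == c' then wcap w b c * f (s1 ++ s2) else 0).
    by apply/funext => c; apply/funext => d; rewrite layer_op_cap.
  rewrite cap_raise mulr0 add0r.
  rewrite [raise_form o1 _ s1 in RHS](@eq_raise_form _ _
    (fun t => if a == a' then wcap w b a * f (t ++ s2) else 0)) //;
    last by move=> t Et; rewrite layer_op_cap // Et.
  rewrite [raise_form o2 _ s2 in RHS](@eq_raise_form _ _
    (fun t => if a == a' then wcap w b a * f (s1 ++ t) else 0)) //;
    last by move=> t Et; rewrite layer_op_cap.
  case: eqP => [<-|_]; last by rewrite !raise_form0 mulr0 addr0.
  by rewrite !raise_formZ (addrA (strand_wt b a)) strand_wtN add0r mulrDr mulrCA.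
Qed.

Lemma amplitude_raise D o o' f s : orientations D o = Some o' ->
    size s = size o ->
  amplitude w D (raise_form o' f) s = raise_form o (amplitude w D f) s.
Proof.
elim: D o s => [|l D IH] o s; first by move=> [<-].
case/orientations_cons => o1 stepl Do Es /=.
rewrite (eq_layer_op _ (g := raise_form o1 (amplitude w D f)) stepl Es).
  exact: layer_op_raise.
by move=> t Et; apply: IH.
Qed.

End Invariance.

(** * Explicit crossing weights *)

Section QuantumBinomials.
Variables (F : fieldType) (x : F).
Hypothesis x_neq0 : x != 0.

Lemma bracket0 : bracket x 0 = 0.
Proof. by rewrite /bracket expr0 invr1 subrr. Qed.

Lemma bracketD m n :
  bracket x (m + n) = x ^+ m * bracket x n + x ^- n * bracket x m.
Proof.
rewrite /bracket !mulrBr -!exprD [x ^- n * x ^+ m]mulrC addrA subrK.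
by rewrite -invfM -exprD addnC.
Qed.

Definition bracket_prod (k m : nat) : F := \prod_(j < m) bracket x (k + j).+1.

Lemma bracket_prod0 k : bracket_prod k 0 = 1.
Proof. by rewrite /bracket_prod big_ord0. Qed.

Lemma bracket_prodS k m :
  bracket_prod k m.+1 = bracket_prod k m * bracket x (k + m).+1.
Proof. by rewrite /bracket_prod big_ord_recr. Qed.

Lemma bracket_prodSl k m :
  bracket_prod k m.+1 = bracket x k.+1 * bracket_prod k.+1 m.
Proof.
rewrite /bracket_prod big_ord_recl addn0; congr (_ * _).
by apply: eq_bigr => j _; rewrite /= addSnnS.
Qed.

(** [qbin b m] is the quantum binomial coefficient of [b + m] over [m], defined by
   a Pascal recursion so that it is visibly a Laurent polynomial and specializes to
   roots of unity, where quotients of quantum factorials break down. *)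
Fixpoint qbin (b : nat) : nat -> F :=
  if b is b'.+1 then
    fix qbin_b m :=
      if m is m'.+1 then x ^+ m * qbin b' m + x ^- b * qbin_b m' else 1
  else fun=> 1.

Lemma qbin0n m : qbin 0 m = 1. Proof. by []. Qed.
Lemma qbinn0 b : qbin b 0 = 1. Proof. by case: b. Qed.
Lemma qbinSS b m :
  qbin b.+1 m.+1 = x ^+ m.+1 * qbin b m.+1 + x ^- b.+1 * qbin b.+1 m.
Proof. by []. Qed.

Lemma qbin_prod b m : qbin b m * bracket_prod 0 m = bracket_prod b m.
Proof.
elim: b m => [|b IHb] m; first by rewrite mul1r.
elim: m => [|m IHm]; first by rewrite qbinn0 mul1r !bracket_prod0.
rewrite qbinSS mulrDl -mulrA IHb (bracket_prodSl b) (bracket_prodS 0) add0n.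
rewrite [x ^- _ * _ * _]mulrACA -IHm (bracket_prodS b.+1) -IHm.
have -> : (b.+1 + m).+1 = (m.+1 + b.+1)%N by lia.
by rewrite bracketD; ring.
Qed.

Hypothesis bracket_neq0 : forall n, bracket x n.+1 != 0.

Lemma bracket_prod_neq0 k m : bracket_prod k m != 0.
Proof. by rewrite /bracket_prod; apply/prodf_neq0 => j _. Qed.

Lemma qbin_ratio b m :
  qbin b m.+1 * bracket x m.+1 = qbin b.+1 m * bracket x b.+1.
Proof.
apply: (mulIf (bracket_prod_neq0 0 m)).
rewrite -mulrA -{1}[m.+1]add0n [bracket x _ * _]mulrC -bracket_prodS qbin_prod.
by rewrite mulrAC qbin_prod bracket_prodSl mulrC.
Qed.

End QuantumBinomials.

Section RTWeights.
Variables (F : fieldType) (x : F) (N : nat).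
Notation I := 'I_N.+1.

(** The matrix coefficient of a crossing, where [m = a - d] (positive) or
   [m = b - c] (negative) is the only summand of the R-matrix that contributes.
   [bracket_prod] collects the coefficients of E^m, cleared of the powers of
   q - 1/q, and [qbin] is the coefficient of the divided power F^m / [m]!. *)
Definition crossing_coef (p : bool) (a b c d : nat) : F :=
  if p then
    if (d <= a)%N && (c + d == a + b)%N then
      x ^ (framed_exp N c d) * x ^+ 'C(a - d, 2)
      * (bracket_prod x (N - a) (a - d) * qbin x b (a - d))
    else 0
  else
    if (c <= b)%N && (c + d == a + b)%N then
      x ^ (- framed_exp N a b) * ((-1) ^+ (b - c) * x ^- 'C(b - c, 2))
      * (bracket_prod x (N - b) (b - c) * qbin x a (b - c))
    else 0.

Definition rt_weights : weights F I :=
  @Weights F I (fun p a b c d => crossing_coef p a b c d)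
    (fun b a => if b then 1 else x ^ (- wt N a))
    (fun b a => if b then x ^ (wt N a) else 1).

Lemma crossing_coef_neq0 p a b c d :
  crossing_coef p a b c d != 0 -> (c + d = a + b)%N.
Proof.
by case: p; rewrite /crossing_coef /=; case: ifP => [/andP[_ /eqP]|]; rewrite ?eqxx.
Qed.

Lemma rt_cross_wt p (a b c d : I) :
  wcross rt_weights p a b c d != 0 -> wt N a + wt N b = wt N c + wt N d.
Proof. by move/crossing_coef_neq0; rewrite /wt; lia. Qed.

Hypothesis x_neq0 : x != 0.

Lemma rt_cup_raise b h :
  \sum_(a : I) wcup rt_weights b a * raise2 x b (~~ b) h a a = 0.
Proof.
rewrite /raise2; under eq_bigr do rewrite mulrDr; rewrite big_split /=.
case: b => /=.
- under eq_bigr do rewrite mul1r mulr_sumr.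
  rewrite exchange_big -big_split big1 // => a _ /=.
  rewrite mul1r -big_split big1 // => c _ /=.
  case: eqP => // _; rewrite ?mul0r ?mulr0 ?addr0 //.
  by rewrite mulNr mulrA subrr.
- under eq_bigr do rewrite mulrA -expfzDr // addNr expr0z mul1r.
  rewrite exchange_big -big_split big1 // => a _ /=.
  rewrite mulr_sumr -big_split big1 // => c _ /=.
  case: eqP => // _; rewrite ?mul0r ?mulr0 ?addr0 //.
  by rewrite mulNr mulrA addNr.
Qed.

Lemma rt_cap_raise b k a a' :
  raise2 x b (~~ b) (fun c c' : I => if c == c' then wcap rt_weights b c * k else 0) a a' = 0.
Proof.
rewrite /raise2 (bigD1 a') //= [X in _ + X](bigD1 a) //= !eqxx.
rewrite big1 => [|c /negPf ne]; last by rewrite ne mulr0.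
rewrite [X in _ + (_ + X)]big1 => [|c /negPf ne]; last by rewrite eq_sym ne mulr0.
rewrite !addr0; case: b => /=; case: eqP => // _; rewrite ?mul0r ?mulr0 ?addr0 //.
- by rewrite -!invr_expz; field; rewrite !expfz_neq0.
- by rewrite -!invr_expz; field; rewrite !expfz_neq0.
Qed.

(** No condition [c < N] appears on the right, since bracket x 0 = 0. *)
Lemma sum_raise_l (c : I) (G : nat -> F) :
  \sum_(e : I) G e * raise x true e c = G c.+1 * bracket x (N - c).
Proof.
rewrite /raise; have [lt_c|ge_c] := ltnP c N.
  rewrite (bigD1 (inord c.+1)) //= big1 => [|e]; rewrite ?inordK ?eqxx ?addr0 //.
  move/eqP=> ne; case: eqP => [E|_]; last by rewrite mulr0.
  by case: ne; apply: val_inj; rewrite /= inordK.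
have -> : c = N :> nat by apply/eqP; rewrite eqn_leq ge_c -ltnS ltn_ord.
rewrite subnn bracket0 mulr0 big1 // => e _; case: eqP => // E; last by rewrite mulr0.
by have := ltn_ord e; rewrite E ltnn.
Qed.

Lemma sum_raise_r (a : I) (G : nat -> F) :
  \sum_(e : I) raise x true a e * G e =
  if (a : nat) is a'.+1 then bracket x (N - a') * G a' else 0.
Proof.
rewrite /raise; case: a => [[|a] lt_a] /=; first by rewrite big1 // => e; rewrite mul0r.
rewrite (bigD1 (inord a)) //= big1 => [|e]; rewrite ?inordK ?eqxx ?addr0 // 1?ltnW //.
move/eqP=> ne; case: eqP => [[E]|_]; last by rewrite mul0r.
by case: ne; apply: val_inj; rewrite /= inordK // 1?ltnW // E.
Qed.

Hypothesis bracket_neq0 : forall n, bracket x n.+1 != 0.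

Lemma framed_expSl c d :
  x ^ (framed_exp N c.+1 d) * x ^ (wt N d) = x ^ (framed_exp N c d).
Proof. by rewrite -expfzDr //; congr (x ^ _); rewrite /framed_exp /wt; lia. Qed.

Lemma framed_expSr c d :
  x ^ (framed_exp N c d.+1) * x ^ (wt N c) = x ^ (framed_exp N c d).
Proof. by rewrite -expfzDr //; congr (x ^ _); rewrite /framed_exp /wt; lia. Qed.

Lemma crossing_coef_out p a b c d : (c + d)%N <> (a + b)%N ->
  crossing_coef p a b c d = 0.
Proof. by move/eqP => ne; apply/eqP; apply: contraNT ne => /crossing_coef_neq0/eqP. Qed.

Lemma crossing_coef_pos m b d :
  crossing_coef true (d + m) b (b + m) d =
  x ^ (framed_exp N (b + m) d) * x ^+ 'C(m, 2)
  * (bracket_prod x (N - (d + m)) m * qbin x b m).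
Proof.
rewrite /crossing_coef leq_addr addKn.
by have -> : (b + m + d == d + m + b)%N by apply/eqP; lia.
Qed.

Lemma crossing_coef_neg m a c :
  crossing_coef false a (c + m) c (a + m) =
  x ^ (- framed_exp N a (c + m)) * ((-1) ^+ m * x ^- 'C(m, 2))
  * (bracket_prod x (N - (c + m)) m * qbin x a m).
Proof.
rewrite /crossing_coef leq_addr addKn.
by have -> : (c + (a + m) == a + (c + m))%N by apply/eqP; lia.
Qed.

Lemma crossing_coef_pos0 a b c d : (a < d)%N -> crossing_coef true a b c d = 0.
Proof. by rewrite /crossing_coef ltnNge => /negPf ->. Qed.

Lemma crossing_coef_neg0 a b c d : (b < c)%N -> crossing_coef false a b c d = 0.
Proof. by rewrite /crossing_coef ltnNge => /negPf ->. Qed.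

Lemma expfz_wt a k : N = (a + k)%N -> x ^ wt N a = x ^+ k / x ^+ a.
Proof.
move=> E; rewrite exprnN exprnP -expfzDr //; congr (x ^ _).
by rewrite /wt; lia.
Qed.

(** Coefficients of [v_c (x) v_d] in P R Delta(E) (right-hand side) and in
   Delta(E) P R (left-hand side), applied to [v_a (x) v_b].  After removal
   of a common factor, Pascal's rule turns the identity into [qbin_ratio]. *)
Lemma crossing_coef_raise_pos a b c d :
    (a <= N)%N -> (b <= N)%N -> (c <= N)%N -> (d <= N)%N -> (c + d).+1 = (a + b)%N ->
  crossing_coef true a b c.+1 d * (x ^ wt N d * bracket x (N - c))
  + crossing_coef true a b c d.+1 * bracket x (N - d) =
  x ^ wt N b * (if a is a'.+1 then bracket x (N - a') * crossing_coef true a' b c d else 0)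
  + (if b is b'.+1 then bracket x (N - b') * crossing_coef true a b' c d else 0).
Proof.
move=> aN bN cN dN E; case: (ltngtP a d) => [lt_ad|lt_da|eq_ad].
- rewrite !crossing_coef_pos0 ?mul0r ?addr0 //; last lia.
  case: a b {E aN bN} lt_ad => [|a] [|b] lt_ad;
    rewrite ?crossing_coef_pos0 ?mulr0 ?addr0 //; lia.
- have [m Ea] : exists m, a = (d + m).+1 by exists (a - d).-1; lia.
  have Ec : c = (b + m)%N by lia.
  have [r EN] : exists r, N = (c + r)%N by exists (N - c)%N; lia.
  subst a c.
  pose X := x ^ framed_exp N (b + m) d; pose Y := x ^+ 'C(m, 2).
  pose P := bracket_prod x (N - (d + m).+1) m.+1.
  have H1 : crossing_coef true (d + m).+1 b (b + m).+1 d * x ^ wt N d =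
      X * (Y * x ^+ m) * (P * qbin x b m.+1).
    rewrite /X -framed_expSl; have := crossing_coef_pos m.+1 b d.
    by rewrite !addnS binS bin1 exprD => ->; rewrite -/Y -/P; ring.
  have H2 : crossing_coef true (d + m).+1 b (b + m) d.+1 * bracket x (N - d)
      * x ^ wt N (b + m) = X * Y * (P * qbin x b m).
    rewrite /X -framed_expSr /P bracket_prodS; have := crossing_coef_pos m b d.+1.
    have -> : (N - (d + m).+1 + m).+1 = (N - d)%N by lia.
    by rewrite !addSn => ->; rewrite -/Y; ring.
  have H3 : bracket x (N - (d + m)) * crossing_coef true (d + m) b (b + m) d =
      X * Y * (P * qbin x b m).
    rewrite crossing_coef_pos /P bracket_prodSl.
    have -> : (N - (d + m).+1).+1 = (N - (d + m))%N by lia.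
    by rewrite -/X -/Y; ring.
  have H4 b' : b = b'.+1 -> crossing_coef true (d + m).+1 b' (b + m) d =
      X * (Y * x ^+ m) * (P * qbin x b' m.+1).
    move=> Eb; rewrite /X /P Eb; have := crossing_coef_pos m.+1 b' d.
    by rewrite !addnS addSn binS bin1 exprD => ->; rewrite -/Y; ring.
  move: H2; rewrite (expfz_wt EN) => H2.
  have {}H2 : crossing_coef true (d + m).+1 b (b + m) d.+1 * bracket x (N - d) =
     X * Y * (P * qbin x b m) * (x ^+ (b + m) / x ^+ r).
    by rewrite -H2; field; rewrite ?expf_neq0.
  rewrite mulrA H1 H2 H3 (@expfz_wt b (m + r)); last by rewrite EN addnA.
  have -> : (N - (b + m) = r)%N by lia.
  clearbody X; clear E lt_da bN cN H1 H2 H3; case: b EN H4 => [|b] EN H4.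
    rewrite addr0 !qbin0n /bracket !exprD expr0; field.
    by rewrite ?oner_eq0 ?expf_neq0 ?x_neq0.
  rewrite (H4 b) //.
  have -> : (N - b = (m + r).+1)%N by lia.
  have R := qbin_ratio x_neq0 bracket_neq0 b m.
  rewrite qbinSS.
  set u := qbin x b m.+1 in R *; set v := qbin x b.+1 m in R *.
  apply/eqP; rewrite -subr_eq0; apply/eqP.
  transitivity (- (X * Y * P * x ^+ m / x ^+ r)
     * (u * bracket x m.+1 - v * bracket x b.+1)); last first.
    by rewrite R subrr mulr0.
  rewrite /bracket !(exprD, exprS); field.
  by rewrite ?expf_neq0 ?x_neq0.
- have Eb : b = c.+1 by lia.
  subst a b; rewrite [crossing_coef _ _ _ c d.+1]crossing_coef_pos0 // mul0r addr0.
  have -> : (if d is a'.+1 then bracket x (N - a') * crossing_coef true a' c.+1 c d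
             else 0) = 0.
    by case: d {E aN dN} => // d; rewrite crossing_coef_pos0 ?mulr0.
  have := crossing_coef_pos 0 c.+1 d; have := crossing_coef_pos 0 c d.
  rewrite !addn0 !bin_small // !bracket_prod0 !qbinn0 => -> ->.
  by rewrite mulr0 add0r !mulr1 mulrA framed_expSl mulrC.
Qed.

Lemma framed_expNl a b :
  x ^ (- framed_exp N a b) * x ^ (wt N b) = x ^ (- framed_exp N a.+1 b).
Proof. by rewrite -expfzDr //; congr (x ^ _); rewrite /framed_exp /wt; lia. Qed.

Lemma framed_expNr a b :
  x ^ (- framed_exp N a b) * x ^ (wt N a) = x ^ (- framed_exp N a b.+1).
Proof. by rewrite -expfzDr //; congr (x ^ _); rewrite /framed_exp /wt; lia. Qed.

(** The same commutation with E, for the inverse R-matrix. *)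
Lemma crossing_coef_raise_neg a b c d :
    (a <= N)%N -> (b <= N)%N -> (c <= N)%N -> (d <= N)%N -> (c + d).+1 = (a + b)%N ->
  crossing_coef false a b c.+1 d * (x ^ wt N d * bracket x (N - c))
  + crossing_coef false a b c d.+1 * bracket x (N - d) =
  x ^ wt N b * (if a is a'.+1 then bracket x (N - a') * crossing_coef false a' b c d else 0)
  + (if b is b'.+1 then bracket x (N - b') * crossing_coef false a b' c d else 0).
Proof.
move=> aN bN cN dN E; case: (ltngtP b c) => [lt_bc|lt_cb|eq_bc].
- rewrite !crossing_coef_neg0 ?mul0r ?addr0 //; last lia.
  case: a b {E aN bN} lt_bc => [|a] [|b] lt_bc;
    rewrite ?crossing_coef_neg0 ?mulr0 ?addr0 //; lia.
- have [m Eb] : exists m, b = (c + m).+1 by exists (b - c).-1; lia.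
  have Ed : d = (a + m)%N by lia.
  have [r EN] : exists r, N = (d + r)%N by exists (N - d)%N; lia.
  subst b d.
  pose X := x ^ (- framed_exp N a (c + m).+1); pose S := (-1) ^+ m / x ^+ 'C(m, 2).
  pose P := bracket_prod x (N - (c + m).+1) m.+1.
  have H1 : crossing_coef false a (c + m).+1 c.+1 (a + m) * bracket x (N - c) =
      X * S * (P * qbin x a m).
    rewrite /P bracket_prodS; have := crossing_coef_neg m a c.+1.
    have -> : (N - (c + m).+1 + m).+1 = (N - c)%N by lia.
    by rewrite !addSn => ->; rewrite -/X -/S; ring.
  have SS : (-1) ^+ m.+1 / x ^+ 'C(m.+1, 2) = - (S / x ^+ m).
    by rewrite binS bin1 exprD invfM exprS /S; ring.
  have H2 : crossing_coef false a (c + m).+1 c (a + m).+1 =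
      - (X * (S / x ^+ m) * (P * qbin x a m.+1)).
    have := crossing_coef_neg m.+1 a c.
    by rewrite !addnS SS => ->; rewrite -/X -/P; ring.
  have H3 a' : a = a'.+1 ->
      x ^ wt N (c + m).+1 * crossing_coef false a' (c + m).+1 c (a + m) =
      - (X * (S / x ^+ m) * (P * qbin x a' m.+1)).
    move=> Ea; rewrite /X /P Ea -framed_expNl; have := crossing_coef_neg m.+1 a' c.
    by rewrite !addnS addSn SS => ->; ring.
  have H4 : bracket x (N - (c + m)) * crossing_coef false a (c + m) c (a + m)
      * x ^ wt N a = X * S * (P * qbin x a m).
    rewrite crossing_coef_neg /X /P bracket_prodSl -framed_expNr -/S.
    have -> : (N - (c + m).+1).+1 = (N - (c + m))%N by lia.
    by ring.
  have EN' : N = (a + (m + r))%N by rewrite addnA.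
  have {}H4 : bracket x (N - (c + m)) * crossing_coef false a (c + m) c (a + m) =
     X * S * (P * qbin x a m) * (x ^+ a / x ^+ (m + r)).
    by rewrite -H4 (expfz_wt EN'); field; rewrite ?expf_neq0.
  rewrite [X in X + _ = _]mulrCA H1.
  rewrite H2 H4 (expfz_wt EN).
  have -> : (N - (a + m) = r)%N by lia.
  clearbody X S; clear E lt_cb aN dN H1 H2 H4; case: a EN EN' H3 => [|a] EN EN' H3.
    rewrite mulr0 add0r !qbin0n /bracket !exprD expr0; field.
    by rewrite ?oner_eq0 ?expf_neq0 ?x_neq0.
  rewrite [x ^ _ * (_ * _)]mulrCA (H3 a) //.
  have -> : (N - a = (m + r).+1)%N by lia.
  have R := qbin_ratio x_neq0 bracket_neq0 a m.
  rewrite qbinSS.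
  set u := qbin x a m.+1 in R *; set v := qbin x a.+1 m in R *.
  apply/eqP; rewrite -subr_eq0; apply/eqP.
  transitivity (X * S * P / (x ^+ m * x ^+ r)
     * (u * bracket x m.+1 - v * bracket x a.+1)); last first.
    by rewrite R subrr mulr0.
  rewrite /bracket !(exprD, exprS); field.
  by rewrite ?expf_neq0 ?x_neq0.
- have Ea : a = d.+1 by lia.
  subst a b; rewrite [crossing_coef _ _ _ c.+1 d]crossing_coef_neg0 // mul0r add0r.
  have -> : (if c is b'.+1 then bracket x (N - b') * crossing_coef false d.+1 b' c d
             else 0) = 0.
    by case: c {E bN cN} => // c; rewrite crossing_coef_neg0 ?mulr0.
  have := crossing_coef_neg 0 d.+1 c; have := crossing_coef_neg 0 d c.
  rewrite !addn0 !bin_small // !bracket_prod0 !qbinn0 => -> ->.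
  by rewrite -framed_expNl; ring.
Qed.

Lemma crossing_coef_raise p (a b c d : nat) :
    (a <= N)%N -> (b <= N)%N -> (c <= N)%N -> (d <= N)%N ->
  crossing_coef p a b c.+1 d * (x ^ wt N d * bracket x (N - c))
  + crossing_coef p a b c d.+1 * bracket x (N - d) =
  x ^ wt N b * (if a is a'.+1 then bracket x (N - a') * crossing_coef p a' b c d else 0)
  + (if b is b'.+1 then bracket x (N - b') * crossing_coef p a b' c d else 0).
Proof.
move=> aN bN cN dN.
have [E|/eqP nE] := eqVneq (c + d).+1 (a + b)%N; last first.
  rewrite !crossing_coef_out ?mul0r ?addr0; try lia.
  case: a b nE {aN bN} => [|a] [|b] nE; rewrite ?crossing_coef_out ?mulr0 ?addr0 //; lia.
case: p; [exact: crossing_coef_raise_pos | exact: crossing_coef_raise_neg].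
Qed.

Lemma rt_cross_raise p h (a b : I) :
  \sum_c \sum_d wcross rt_weights p a b c d * raise2 x true true h c d =
  raise2 x true true
    (fun a b => \sum_c \sum_d wcross rt_weights p a b c d * h c d) a b.
Proof.
pose C := crossing_coef p.
transitivity (\sum_(c : I) \sum_(d : I) h c d *
   (C a b c.+1 d * (x ^ wt N d * bracket x (N - c)) + C a b c d.+1 * bracket x (N - d))).
  rewrite /raise2 /=.
  under eq_bigr => c _ do under eq_bigr => d _ do rewrite mulrDr.
  under eq_bigr => c _ do rewrite big_split.
  under [RHS]eq_bigr => c _ do under eq_bigr => d _ do rewrite mulrDr.
  under [RHS]eq_bigr => c _ do rewrite big_split.
  rewrite !big_split; congr (_ + _) => /=.
  - rewrite exchange_big [RHS]exchange_big; apply: eq_bigr => d _.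
    under eq_bigr => c _ do rewrite !mulr_sumr.
    rewrite exchange_big; apply: eq_bigr => c _ /=.
    have /= E := sum_raise_l c (fun e : nat => C a b e d).
    rewrite [RHS](_ : _ = h c d * x ^ wt N d * (C a b c.+1 d * bracket x (N - c)));
      last by ring.
    rewrite -E mulr_sumr; apply: eq_bigr => e _.
    by rewrite /C; ring.
  - apply: eq_bigr => c _.
    under eq_bigr => d _ do rewrite !mulr_sumr.
    rewrite exchange_big; apply: eq_bigr => d _ /=.
    have /= E := sum_raise_l d (fun e : nat => C a b c e).
    rewrite -E.
    by rewrite mulr_sumr; apply: eq_bigr => e _; rewrite /C; ring.
rewrite /raise2 /=.
rewrite (sum_raise_r a (fun e => \sum_(c : I) \sum_(d : I) C e b c d * h c d)).
rewrite (sum_raise_r b (fun e => \sum_(c : I) \sum_(d : I) C a e c d * h c d)).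
under eq_bigr => c _ do under eq_bigr => d _ do
  rewrite crossing_coef_raise ?leq_ord // mulrDr.
under eq_bigr => c _ do rewrite big_split.
rewrite big_split; congr (_ + _) => /=.
- case: {+}(a : nat) => [|a'].
    by rewrite mulr0 big1 // => c _; rewrite big1 // => d _; rewrite !mulr0.
  rewrite !mulr_sumr; apply: eq_bigr => c _; rewrite !mulr_sumr.
  by apply: eq_bigr => d _; rewrite /C; ring.
- case: {+}(b : nat) => [|b'].
    by rewrite big1 // => c _; rewrite big1 // => d _; rewrite !mulr0.
  rewrite !mulr_sumr; apply: eq_bigr => c _; rewrite !mulr_sumr.
  by apply: eq_bigr => d _; rewrite /C; ring.
Qed.

End RTWeights.

(** * The weights at generic q *)

Lemma q_neq0 : q != 0.
Proof. by rewrite /q tofrac_eq0 polyX_eq0. Qed.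

Lemma bracket_q_neq0 n : bracket q n.+1 != 0.
Proof.
rewrite /bracket subr_eq0; apply/negP => /eqP E.
have: q ^+ (n.+1 + n.+1) = 1.
  by rewrite exprD {1}E mulVf // expf_neq0 // q_neq0.
rewrite /q -rmorphXn -[1]/(tofrac 1) => /eqP; rewrite tofrac_eq => /eqP.
move/(congr1 (fun p : {poly int} => size p)).
by rewrite size_polyXn size_poly1.
Qed.

Lemma qint_bracket n : qint n = bracket q n / bracket q 1.
Proof. by rewrite /qint /bracket expr1. Qed.

Lemma Emx_exp N m (d a : 'I_N.+1) : (Emx N ^+ m) d a =
  if (d + m == a)%N then \prod_(j < m) qint (N - a + j).+1 else 0.
Proof.
elim: m d => [|m IH] d.
  rewrite expr0 mxE addn0 big_ord0 -val_eqE /=; by case: eqP.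
rewrite exprS mxE; case: eqP => [E|nE].
  have lt_d : (d.+1 < N.+1)%N by have := ltn_ord a; lia.
  rewrite (bigD1 (Ordinal lt_d)) //= big1 ?addr0.
    rewrite IH mxE /= eqxx addSnnS E eqxx big_ord_recr mulrC; congr (_ * qint _.+1).
    by have := ltn_ord a; rewrite /=; lia.
  move=> e ne; rewrite mxE; case: eqP => [Ee|_]; last by rewrite mul0r.
  by case/eqP: ne; apply: val_inj.
rewrite big1 // => e _; rewrite mxE IH; case: eqP => [Ee|_]; last by rewrite mul0r.
by case: eqP => [Ea|_]; [case: nE; lia | rewrite mulr0].
Qed.

Lemma Fmx_exp N m (c b : 'I_N.+1) : (Fmx N ^+ m) c b =
  if (c == b + m :> nat)%N then \prod_(j < m) qint (b + j).+1 else 0.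
Proof.
elim: m c => [|m IH] c.
  rewrite expr0 mxE addn0 big_ord0 -val_eqE /=; by case: eqP.
rewrite exprS mxE; case: eqP => [E|nE].
  have lt_d : (b + m < N.+1)%N by have := ltn_ord c; lia.
  rewrite (bigD1 (Ordinal lt_d)) //= big1 ?addr0.
    by rewrite IH mxE /= E addnS !eqxx big_ord_recr mulrC.
  move=> e ne; rewrite IH; case: eqP => [Ee|_]; last by rewrite mulr0.
  by case/eqP: ne; apply: val_inj.
rewrite big1 // => e _; rewrite mxE IH; case: eqP => [Ee|_]; last by rewrite mul0r.
by case: eqP => [Ea|_]; [case: nE; lia | rewrite mulr0].
Qed.

Lemma prod_qint k m :
  \prod_(j < m) qint (k + j).+1 = bracket_prod q k m / bracket q 1 ^+ m.
Proof.
rewrite /bracket_prod -[X in _ ^+ X](card_ord m) -prodr_const -prodf_div.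
by apply: eq_bigr => j _; rewrite qint_bracket.
Qed.

Lemma qfact_bracket m : qfact m = bracket_prod q 0 m / bracket q 1 ^+ m.
Proof.
rewrite -prod_qint /qfact big_add1 big_mkord.
by apply: eq_bigr => j _; rewrite add0n.
Qed.

(** The next three identities are stated in an arbitrary field: in the field of
   rational functions, field arithmetic would unfold the construction of
   fractions. *)
Lemma scaled_ratio (F : fieldType) (u P K g : F) : u != 0 -> P != 0 ->
  u / (P / u) * (K / u) * (g * P / u) = K * g.
Proof. by move=> u0 P0; field; rewrite u0. Qed.

Lemma term_comm_pos (F : fieldType) (e u y k A B : F) :
  e * (u * y / k * A * B) = e * y * (u / k * A * B).
Proof. by ring. Qed.

Lemma term_comm_neg (F : fieldType) (e s u y k A B : F) :
  e * (s * u / y / k * A * B) = e * (s / y) * (u / k * A * B).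
Proof. by ring. Qed.

Lemma crossing_term k b m :
  (q - q^-1) ^+ m / qfact m * (\prod_(j < m) qint (k + j).+1)
    * (\prod_(j < m) qint (b + j).+1) = bracket_prod q k m * qbin q b m.
Proof.
rewrite !prod_qint qfact_bracket -(qbin_prod q_neq0 b).
have -> : q - q^-1 = bracket q 1 by rewrite /bracket expr1.
have B := bracket_q_neq0 0; have P := bracket_prod_neq0 bracket_q_neq0 0 m.
exact: (scaled_ratio _ _ (expf_neq0 m B) P).
Qed.

Lemma crossing_coefE N p (a b c d : 'I_N.+1) :
  crossing p a b c d = crossing_coef q N p a b c d.
Proof.
rewrite /crossing /crossing_coef; case: p.
- case: ifP => [/andP[le_da /eqP E]|nE].
    have lt_m : (a - d < N.+1)%N by have := ltn_ord a; lia.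
    rewrite (bigD1 (Ordinal lt_m)) //= big1 ?addr0 => [|m ne].
      rewrite Emx_exp Fmx_exp subnKC // eqxx.
      have -> : (c == b + (a - d) :> nat)%N by apply/eqP; lia.
      by rewrite -crossing_term term_comm_pos.
    rewrite Emx_exp; case: eqP => [Ea|_]; last by rewrite mulr0 mul0r.
    by case/eqP: ne; apply: val_inj; rewrite /= -Ea addKn.
  rewrite big1 ?mulr0 // => m _; rewrite Emx_exp Fmx_exp.
  case: eqP => [Ea|_]; last by rewrite mulr0 mul0r.
  case: eqP => [Ec|_]; last by rewrite mulr0.
  by move/negP: nE; case; apply/andP; split; [|apply/eqP]; lia.
- case: ifP => [/andP[le_da /eqP E]|nE].
    have lt_m : (b - c < N.+1)%N by have := ltn_ord b; lia.
    rewrite (bigD1 (Ordinal lt_m)) //= big1 ?addr0 => [|m ne].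
      rewrite Emx_exp Fmx_exp subnKC // eqxx.
      have -> : (d == a + (b - c) :> nat)%N by apply/eqP; lia.
      rewrite -crossing_term -[q^-1 - q]opprB (exprNn (q - q^-1)).
      by rewrite term_comm_neg.
    rewrite Emx_exp; case: eqP => [Ea|_]; last by rewrite mulr0 mul0r.
    by case/eqP: ne; apply: val_inj; rewrite /= -Ea addKn.
  rewrite big1 ?mulr0 // => m _; rewrite Emx_exp Fmx_exp.
  case: eqP => [Ea|_]; last by rewrite mulr0 mul0r.
  case: eqP => [Ec|_]; last by rewrite mulr0.
  by move/negP: nE; case; apply/andP; split; [|apply/eqP]; lia.
Qed.

Lemma state_sumE N D (s : seq 'I_N.+1) :
  state_sum D s = amplitude (rt_weights q N) D (fun t => (nilp t)%:R) s.
Proof.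
elim: D s => [|[p i|b i|b i] D IH] s //=; rewrite /layer_op.
- case: (drop i s) => [|a [|b r]] //; apply: eq_bigr => c _; apply: eq_bigr => d _.
  by rewrite crossing_coefE IH.
- by apply: eq_bigr => a _; rewrite IH.
- by case: (drop i s) => [|a [|a' r]] //; rewrite IH.
Qed.

(** * Values of Laurent polynomials *)

Section LaurentValues.
Variables (R : realType) (z : R[i]).
Hypothesis z_neq0 : z != 0.
Notation lv f v := (laurent_value f z v).

Lemma laurent_value_uniq f u v : lv f u -> lv f v -> u = v.
Proof.
move=> [p [m [-> ->]]] [p' [m' [E ->]]].
have qn k : q ^+ k != 0 by rewrite expf_neq0 // q_neq0.
have zn k : z ^+ k != 0 by rewrite expf_neq0.
have {}E : p * 'X^m' = p' * 'X^m.
  apply/eqP; rewrite -tofrac_eq !rmorphM !rmorphXn /= -/q; apply/eqP.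
  by move/eqP: E; rewrite (eqr_div _ _ (qn m) (qn m')) => /eqP.
apply/eqP; rewrite (eqr_div _ _ (zn m) (zn m')); apply/eqP.
have := congr1 (fun r => (map_poly intr r).[z]) E.
by rewrite !rmorphM /= !map_polyXn !hornerM !hornerXn.
Qed.

Lemma laurent_value_poly p : lv (tofrac p) (map_poly intr p).[z].
Proof. by exists p, 0%N; rewrite !expr0 !divr1. Qed.

Lemma laurent_value1 : lv 1 1.
Proof. by have := laurent_value_poly 1; rewrite !rmorph1 hornerC. Qed.

Lemma laurent_value0 : lv 0 0.
Proof. by have := laurent_value_poly 0; rewrite !rmorph0 horner0. Qed.

Lemma laurent_valueD f g u v : lv f u -> lv g v -> lv (f + g) (u + v).
Proof.
move=> [p [m [-> ->]]] [p' [m' [-> ->]]].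
exists (p * 'X^m' + p' * 'X^m), (m + m')%N.
have qn k : q ^+ k != 0 by rewrite expf_neq0 // q_neq0.
have zn k : z ^+ k != 0 by rewrite expf_neq0.
rewrite !exprD !rmorphD !rmorphM /= !rmorphXn /= -/q !map_polyX.
rewrite hornerD !hornerM !hornerXn; split.
  by rewrite (addf_div _ _ (qn m) (qn m')).
by rewrite (addf_div _ _ (zn m) (zn m')).
Qed.

Lemma laurent_valueM f g u v : lv f u -> lv g v -> lv (f * g) (u * v).
Proof.
move=> [p [m [-> ->]]] [p' [m' [-> ->]]].
exists (p * p'), (m + m')%N.
by rewrite !exprD !rmorphM /= hornerM !invfM; split; rewrite mulrACA.
Qed.

Lemma laurent_valueN f u : lv f u -> lv (- f) (- u).
Proof.
move=> [p [m [-> ->]]]; exists (- p), m.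
by rewrite !rmorphN hornerN !mulNr.
Qed.

Lemma laurent_value_sum (J : finType) (f : J -> Qq) (u : J -> R[i]) :
  (forall j, lv (f j) (u j)) -> lv (\sum_j f j) (\sum_j u j).
Proof.
move=> fu; apply: (big_ind2 (fun a b => lv a b)) => //.
- exact: laurent_value0.
- by move=> *; apply: laurent_valueD.
Qed.

Lemma laurent_value_prod (J : finType) (f : J -> Qq) (u : J -> R[i]) :
  (forall j, lv (f j) (u j)) -> lv (\prod_j f j) (\prod_j u j).
Proof.
move=> fu; apply: (big_ind2 (fun a b => lv a b)) => //.
- exact: laurent_value1.
- by move=> *; apply: laurent_valueM.
Qed.

Lemma laurent_value_exp f u n : lv f u -> lv (f ^+ n) (u ^+ n).
Proof.
move=> fu; elim: n => [|n IH]; first exact: laurent_value1.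
by rewrite !exprS; apply: laurent_valueM.
Qed.

Lemma laurent_value_q n : lv (q ^+ n) (z ^+ n).
Proof.
apply: laurent_value_exp; have := laurent_value_poly 'X.
by rewrite map_polyX hornerX.
Qed.

Lemma laurent_value_qV n : lv (q ^- n) (z ^- n).
Proof. by exists 1, n; rewrite !rmorph1 hornerC !mul1r. Qed.

Lemma laurent_value_qz (n : int) : lv (q ^ n) (z ^ n).
Proof.
by case: n => n; [exact: laurent_value_q | rewrite NegzE -!exprnN; exact: laurent_value_qV].
Qed.

Lemma laurent_value_bracket n : lv (bracket q n) (bracket z n).
Proof.
apply: laurent_valueD (laurent_value_q n) _.
exact: laurent_valueN (laurent_value_qV n).
Qed.

Lemma laurent_value_qbin b m : lv (qbin q b m) (qbin z b m).
Proof.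
elim: b m => [|b IHb] m; first exact: laurent_value1.
elim: m => [|m IHm]; first exact: laurent_value1.
rewrite !qbinSS; apply: laurent_valueD; apply: laurent_valueM => //.
- exact: laurent_value_q.
- exact: laurent_value_qV.
Qed.

Lemma laurent_value_crossing N p a b c d :
  lv (crossing_coef q N p a b c d) (crossing_coef z N p a b c d).
Proof.
rewrite /crossing_coef; case: p; case: ifP => _; try exact: laurent_value0;
  repeat apply: laurent_valueM.
all: try exact: laurent_value_qz.
all: try exact: laurent_value_q.
all: try exact: laurent_value_qV.
all: try exact: laurent_value_qbin.
- by apply: laurent_value_prod => j; apply: laurent_value_bracket.
- apply: laurent_value_exp; apply: laurent_valueN; exact: laurent_value1.
- by apply: laurent_value_prod => j; apply: laurent_value_bracket.
Qed.

Lemma laurent_value_amplitude N D f g (s : seq 'I_N.+1) :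
    (forall t, lv (f t) (g t)) ->
  lv (amplitude (rt_weights q N) D f s) (amplitude (rt_weights z N) D g s).
Proof.
move=> fg; elim: D s => [|x D IH] s //=.
case: x => [p i|b i|b i]; rewrite /layer_op.
- case: (drop i s) => [|a [|b r]]; try exact: laurent_value0.
  apply: laurent_value_sum => c; apply: laurent_value_sum => d.
  by apply: laurent_valueM => //; apply: laurent_value_crossing.
- apply: laurent_value_sum => a; apply: laurent_valueM => //=.
  by case: b; [exact: laurent_value1 | exact: laurent_value_qz].
- case: (drop i s) => [|a [|a' r]]; try exact: laurent_value0.
  case: ifP => _; last exact: laurent_value0.
  apply: laurent_valueM => //=.
  by case: b; [exact: laurent_value_qz | exact: laurent_value1].
Qed.

End LaurentValues.

(** * Cutting a knot open *)

Lemma orientations_rcons D x o :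
  orientations (rcons D x) o = obind (layer_orientations x) (orientations D o).
Proof.
elim: D o => [|y D IH] o /=; first by case: layer_orientations.
by case: layer_orientations.
Qed.

(** The last layer of a closed diagram is necessarily a cap at position 0. *)
Lemma knot_cut (K : knot) : exists D b,
  [/\ knot_word K = rcons D (Cap b 0), orientations D [::] = Some [:: b; ~~ b]
    & components (rcons D (Cap b 0)) [::] = 1%N].
Proof.
case: K => w /= /andP[/eqP Ow /eqP Cw].
case/lastP: w Ow Cw => [|D x] //= Ow Cw.
rewrite orientations_rcons in Ow.
case Eo: (orientations D [::]) Ow => [ o|] //= /layer_stepP stepx.
move: stepx Eo Cw; move Eo': [::] => o' stepx.
case: stepx Eo' => [p|b|b] [|u o1] [|v o2] //= _ Eo Cw.
by exists D, b.
Qed.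

Section OpenValues.
Variables (F : fieldType) (x : F) (N : nat).
Notation I := 'I_N.+1.
Implicit Types (D : diagram) (b : bool).

(** The scalar by which the cut knot acts on [v_a].  The power of x turns a
   coefficient in [V^* (x) V], where the invariant vector is the sum of the
   [v^a (x) K^-1 v_a], into that scalar. *)
Definition open_value b D (a : I) : F :=
  (if b then 1 else x ^ wt N a)
  * amplitude (rt_weights x N) D (indicator F [:: a; a]) [::].

Hypothesis x_neq0 : x != 0.

Lemma sum_raise_indicator v (c u : I) (P : pred I) (d : bool) :
  (forall e, P e = (e == u) && d) ->
  \sum_e raise x v c e * (P e)%:R = raise x v c u * d%:R.
Proof.
move=> PE; rewrite (bigD1 u) //= big1 => [|e /negPf ne].
  by rewrite addr0 PE eqxx.
by rewrite PE ne mulr0.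
Qed.

Lemma raise_form_indicator b (u v c e : I) :
  raise_form x [:: b; ~~ b] (indicator F [:: u; v]) [:: c; e] =
  x ^ strand_wt (~~ b) e * (raise x b c u * (e == v)%:R)
  + raise x (~~ b) e v * (c == u)%:R.
Proof.
rewrite /= !addr0 expr0z mul1r /indicator.
rewrite (@sum_raise_indicator _ _ u _ (e == v)) ?(@sum_raise_indicator _ _ v _ (c == u)) //.
- by move=> d; rewrite !eqseq_cons andbT andbC.
- by move=> d; rewrite !eqseq_cons andbT.
Qed.

(** The coefficient of [v_a (x) v^(a+1)] (or its mirror image) in E applied to the
   invariant vector of [D] is zero and involves only the diagonal coefficients
   at [a] and [a + 1]. *)
Lemma open_valueS b D (a a' : I) : orientations D [::] = Some [:: b; ~~ b] ->
  (forall n, bracket x n.+1 != 0) ->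
  a' = a.+1 :> nat -> open_value b D a = open_value b D a'.
Proof.
move=> D_open br_neq0 Ea.
have raise0 f : amplitude (rt_weights x N) D (raise_form x [:: b; ~~ b] f) [::] = 0
  := @amplitude_raise F x N _ x_neq0 (@rt_cross_wt F x N)
  (rt_cross_raise x_neq0 br_neq0) (rt_cup_raise x_neq0) (rt_cap_raise x_neq0)
  D [::] _ f [::] D_open erefl.
have br0 : bracket x (N - a) != 0.
  have := ltn_ord a'; rewrite Ea ltnS => lt_a.
  by rewrite -(@prednK (N - a)) // subn_gt0.
have xz n : x ^ n != 0 by rewrite expfz_neq0.
pose w (j : bool) := if j then a' else a.
have amp2 f k : (forall c e, f [:: c; e] =
    \sum_j k j * indicator F [:: w j; w j] [:: c; e]) ->
  amplitude (rt_weights x N) D f [::] =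
  k true * amplitude (rt_weights x N) D (indicator F [:: a'; a']) [::]
  + k false * amplitude (rt_weights x N) D (indicator F [:: a; a]) [::].
  move=> fk; rewrite (@eq_amplitude _ _ _ D [::] [:: b; ~~ b] _
    (fun s => \sum_j k j * indicator F [:: w j; w j] s)) //.
    by rewrite amplitude_lin big_bool.
  by case=> [|c [|e []]].
rewrite /open_value; case: b D_open raise0 amp2 => D_open raise0 amp2.
- have := raise0 (indicator F [:: a; a']).
  rewrite (amp2 _ (fun j : bool =>
    if j then x ^ (- wt N a') * bracket x (N - a)
    else - (x ^ (- wt N a') * bracket x (N - a)))).
    move/eqP; rewrite /= mulNr subr_eq0 => /eqP/mulfI ->; rewrite ?mul1r //.
    by rewrite mulf_neq0.
  move=> c e; rewrite raise_form_indicator big_bool /indicator !eqseq_cons !andbT /=.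
  have [->|ne] := eqVneq e a'.
    have -> : (a' == a) = false by rewrite -val_eqE /= Ea; apply/eqP; lia.
    have -> : (a' == a'.+1 :> nat) = false by apply/eqP; lia.
    rewrite andbF andbT -Ea val_eqE; case: (c == a'); rewrite /= ?(mulr1, mulr0, mul0r, addr0) //.
  have -> : (a' == e.+1 :> nat) = (e == a) by rewrite Ea eqSS -val_eqE eq_sym.
  rewrite andbF !mulr0 !add0r; case: eqP => [->|_]; case: (c == a);
    by rewrite /= ?(mulr1, mulr0, mul0r).
- have := raise0 (indicator F [:: a'; a]).
  rewrite (amp2 _ (fun j : bool =>
    if j then bracket x (N - a)
    else - (x ^ wt N a / x ^ wt N a' * bracket x (N - a)))).
    move=> /eqP; rewrite /= mulNr subr_eq0 => /eqP E.
    apply: (mulfI br0); rewrite [RHS]mulrCA E.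
    by field; rewrite xz.
  move=> c e; rewrite raise_form_indicator big_bool /indicator !eqseq_cons !andbT /=.
  have -> : (a' == c.+1 :> nat) = (c == a) by rewrite Ea eqSS -val_eqE eq_sym.
  have -> : (e == a.+1 :> nat) = (e == a') by rewrite -Ea val_eqE.
  have ne : (a == a') = false by rewrite -val_eqE /= Ea; apply/eqP; lia.
  have [->|_] := eqVneq e a.
    rewrite ne !andbT !andbF; have [->|_] := eqVneq c a.
      by rewrite -!invr_expz ne mulr0n mulr1n; field; rewrite xz.
    by rewrite ?(mulr0n, mulr0, mul0r, addr0).
  have [->|_] := eqVneq c a'; case: (e == a');
    by rewrite ?andbF ?(mulr1n, mulr0n, mulr0, mul0r, addr0, mulr1, add0r).
Qed.

Lemma open_value_const b D (a a' : I) : orientations D [::] = Some [:: b; ~~ b] ->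
  (forall n, bracket x n.+1 != 0) -> open_value b D a = open_value b D a'.
Proof.
move=> D_open br_neq0.
suff E0 (c : I) : open_value b D c = open_value b D ord0 by rewrite !E0.
case: c => n; elim: n => [|n IH] lt_n.
  by congr open_value; apply: val_inj.
by rewrite -(IH (ltnW lt_n)); symmetry; apply: open_valueS.
Qed.

(** The quantum dimension, as a telescoping sum. *)
Lemma sum_wt : (x - x^-1) * \sum_(a : I) x ^ wt N a = bracket x N.+1.
Proof.
rewrite mulr_sumr.
pose G n : F := - x ^ (N.+1%:Z - (2 * n)%N%:Z).
transitivity (\sum_(0 <= n < N.+1) (G n.+1 - G n)).
  rewrite big_mkord; apply: eq_bigr => a _.
  have G1 : G a = - (x ^ wt N a * x).
    rewrite -[X in _ * X]expr1z -expfzDr //; congr (- x ^ _).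
    by rewrite /wt; lia.
  have G2 : G a.+1 = - (x ^ wt N a * x^-1).
    rewrite -exprN1 -expfzDr //; congr (- x ^ _).
    by rewrite /wt; lia.
  by rewrite G1 G2; ring.
rewrite telescope_sumr // /G opprK addrC /bracket muln0 subr0; congr (_ - _).
by rewrite exprnN; congr (x ^ _); lia.
Qed.

End OpenValues.

Lemma wtN_exp (F : fieldType) (x : F) N (a : nat) : x ^ (- wt N a) = x^-1 ^ wt N a.
Proof. by rewrite exprz_inv. Qed.

Lemma sum_wtN (F : fieldType) (x : F) N : x != 0 ->
  (x - x^-1) * \sum_(a < N.+1) x ^ (- wt N a) = bracket x N.+1.
Proof.
move=> x0; under eq_bigr do rewrite wtN_exp.
have := @sum_wt F x^-1 N (invr_neq0 x0); rewrite invrK => E.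
by rewrite -opprB mulNr E /bracket !exprVn invrK opprB.
Qed.

(** The closing cap sums the diagonal coefficients with the pivotal weights, which
   gives the quantum dimension times their common value. *)
Lemma colored_jones_open N (K : knot) D b (a : 'I_N.+1) :
    knot_word K = rcons D (Cap b 0) -> orientations D [::] = Some [:: b; ~~ b] ->
  colored_jones N K = open_value q b D a.
Proof.
move=> EK Do; rewrite /colored_jones state_sumE EK -cats1 /amplitude foldr_cat.
rewrite -!/(amplitude _ _ _) /=.
pose k (c : 'I_N.+1) := wcap (rt_weights q N) b c.
rewrite (@eq_amplitude _ _ _ D [::] [:: b; ~~ b] _
  (fun s => \sum_c k c * indicator Qq [:: c; c] s)) //; last first.
  case=> [|c [|e []]] // _; rewrite /layer_op /= mulr1 /indicator.
  case: eqP => [<-|ne].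
    rewrite (bigD1 c) //= eqxx mulr1 big1 ?addr0 // => d /negPf ned.
    by rewrite !eqseq_cons eq_sym ned mulr0.
  rewrite big1 // => d _; rewrite !eqseq_cons andbT.
  by case: eqP => [<-|_]; rewrite ?mulr0 //; case: eqP => [E|_]; [case: ne|rewrite mulr0].
rewrite amplitude_lin.
have -> : \sum_c k c * amplitude (rt_weights q N) D (indicator Qq [:: c; c]) [::]
    = (\sum_(c < N.+1) q ^ (if b then wt N c else - wt N c)) * open_value q b D a.
  rewrite mulr_suml; apply: eq_bigr => c _.
  rewrite (open_value_const q_neq0 a c Do bracket_q_neq0) /open_value /k /=.
  case: (b); first by rewrite mul1r.
  by rewrite mul1r mulrA -(expfzDr _ _ q_neq0) addNr expr0z mul1r.
have q1 : q - q^-1 != 0.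
  by have := bracket_q_neq0 0; rewrite /bracket expr1.
have Eq : qint N.+1 = \sum_(c < N.+1) q ^ (if b then wt N c else - wt N c).
  apply: (mulfI q1); rewrite /qint mulrC (divfK q1).
  by case: (b); [rewrite (sum_wt _ q_neq0) | rewrite (sum_wtN _ q_neq0)].
have qN : qint N.+1 != 0.
  rewrite qint_bracket; apply: mulf_neq0; first exact: bracket_q_neq0.
  exact: invr_neq0 (bracket_q_neq0 0).
by rewrite -Eq mulrAC (divff qN) mul1r.
Qed.

(** * Following the strand of a cut knot *)

Lemma components_cross p i D (l1 l2 : seq nat) u v : size l1 = i ->
  components (Cross p i :: D) (l1 ++ u :: v :: l2) = components D (l1 ++ v :: u :: l2).
Proof. by move=> <- /=; rewrite drop_size_cat // take_size_cat. Qed.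

Lemma components_cup b i D (l1 l2 : seq nat) : size l1 = i ->
  components (Cup b i :: D) (l1 ++ l2) =
  let f := (foldr maxn 0%N (l1 ++ l2)).+1 in components D (l1 ++ f :: f :: l2).
Proof. by move=> <- /=; rewrite drop_size_cat // take_size_cat. Qed.

Lemma components_cap b i D (l1 l2 : seq nat) u v : size l1 = i ->
  components (Cap b i :: D) (l1 ++ u :: v :: l2) =
  if u == v then (components D (l1 ++ l2)).+1
  else components D [seq (if c == v then u else c) | c <- l1 ++ l2].
Proof. by move=> <- /=; rewrite drop_size_cat // take_size_cat. Qed.

Lemma fresh_notin (l : seq nat) : (foldr maxn 0%N l).+1 \notin l.
Proof.
suff le_max x : x \in l -> (x <= foldr maxn 0%N l)%N.
  by apply/negP => /le_max; rewrite ltnn.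
elim: l => //= y l IH; rewrite inE leq_max => /orP[/eqP ->|/IH ->].
  by rewrite leqnn.
by rewrite orbT.
Qed.

Section StrandLists.
Variables (I : finType) (P : pred I).

(** A strand at a horizontal level carries the label of [components], its
   orientation and its index in the state under consideration. *)
Definition strand := (nat * bool * I)%type.
Implicit Types (T R : seq strand) (z : strand).
Definition label z := z.1.1.
Definition upward z := z.1.2.
Definition index z := z.2.

(** Each arc below the level enters it through a downward strand and leaves it
   through an upward one, so every label occurs once with each orientation.  The
   last clause propagates the closed set [P] along the arcs below. *)
Record well_linked T : Prop := WellLinked {
  linked_uniq : uniq (map fst T);
  linked_both : forall x, ((x, true) \in map fst T) = ((x, false) \in map fst T);
  linked_index : forall x i j,
    (x, true, i) \in T -> (x, false, j) \in T -> P j -> P i }.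

Lemma well_linked_perm T T' : perm_eq T T' -> well_linked T -> well_linked T'.
Proof.
move=> TT' [T1 T2 T3]; have TT'1 := perm_map fst TT'; split.
- by rewrite -(perm_uniq TT'1).
- by move=> x; rewrite -!(perm_mem TT'1).
- by move=> x i j; rewrite -!(perm_mem TT'); apply: T3.
Qed.

Lemma fst_mem z T : z \in T -> z.1 \in map fst T.
Proof. exact: map_f. Qed.

Lemma well_linked_cross x y a b c d R :
    (P a -> P d) -> (P b -> P c) ->
  well_linked [:: (x, true, a), (y, true, b) & R] ->
  well_linked [:: (y, true, c), (x, true, d) & R].
Proof.
move=> Pad Pbc [T1 T2 T3].
have perm12 : perm_eq [:: (x, true), (y, true) & map fst R]
                      [:: (y, true), (x, true) & map fst R].
  by rewrite (perm_catCA [:: (x, true)] [:: (y, true)]).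
split.
- by rewrite -[map fst _]/[:: (y, true), (x, true) & map fst R] -(perm_uniq perm12).
- move=> w; rewrite -[map fst _]/[:: (y, true), (x, true) & map fst R].
  by rewrite -!(perm_mem perm12).
- move=> w i j; rewrite !inE => /or3P[/eqP[-> ->]|/eqP[-> ->]|Ri] /or3P[/eqP[]//|/eqP[]//|Rj] Pj.
  + by apply/Pbc/(T3 y b j) => //; rewrite !inE ?eqxx ?Rj ?orbT.
  + by apply/Pad/(T3 x a j) => //; rewrite !inE ?eqxx ?Rj ?orbT.
  + by apply: (T3 w i j) => //; rewrite !inE ?Ri ?Rj !orbT.
Qed.

Lemma well_linked_cup f b a R : f \notin map label R ->
  well_linked R -> well_linked [:: (f, b, a), (f, ~~ b, a) & R].
Proof.
move=> fR [R1 R2 R3].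
have fR' o : (f, o) \in map fst R = false.
  apply/negP => /mapP[z Rz E]; case/negP: fR; apply/mapP; exists z => //.
  by rewrite /label -E.
have fR3 o i : (f, o, i) \in R = false.
  by apply/negP => /fst_mem; rewrite fR'.
split.
- by rewrite /= inE !fR' R1 xpair_eqE eqxx; case: b.
- by move=> w; rewrite /= !inE R2 !xpair_eqE; case: b; case: (w == f).
- move=> w i j; rewrite !inE => /or3P[/eqP[-> _ ->]|/eqP[-> _ ->]|Ri].
  + by rewrite fR3 orbF => /orP[] /eqP[_ ->].
  + by rewrite fR3 orbF => /orP[] /eqP[_ ->].
  + case/or3P => [/eqP[Ew _ _]|/eqP[Ew _ _]|Rj]; last exact: R3 Ri Rj.
    * by rewrite Ew fR3 in Ri.
    * by rewrite Ew fR3 in Ri.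
Qed.

Definition relabel (rho : nat -> nat) z : strand := (rho (label z), upward z, index z).

(** Joining the upward end of arc [u] to the downward end of arc [v]
   leaves one arc, running from the downward end of [u] to the upward end of
   [v]. *)
Lemma well_linked_cap (u v : nat) i rho R : u <> v ->
    rho u = rho v -> (rho u = u \/ rho u = v) ->
    (forall c, c <> u -> c <> v -> rho c = c) ->
    well_linked [:: (u, true, i), (v, false, i) & R] ->
  well_linked (map (relabel rho) R).
Proof.
move=> neq_uv rho_uv rho_u rho_id [T1 T2 T3].
have rho_inj c c' : rho c = rho c' ->
    c = c' \/ ((c = u \/ c = v) /\ (c' = u \/ c' = v)).
  have := rho_id c; have := rho_id c'.
  by case: (c =P u) (c =P v) (c' =P u) (c' =P v) => [?|?] [?|?] [?|?] [?|?];
    intuition congruence.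
move: T1; rewrite /= !inE negb_or => /and3P[/andP[_ uR] vR R1].
have uRF j : (u, true, j) \in R = false.
  by apply/negP => /fst_mem; apply/negP.
have vRF j : (v, false, j) \in R = false.
  by apply/negP => /fst_mem; apply/negP.
have memR w o : ((w, o) \in map fst (map (relabel rho) R)) =
    has (fun c : nat * bool => (rho c.1 == w) && (c.2 == o)) (map fst R).
  rewrite has_map -map_comp; apply/mapP/hasP => [[z Rz [-> ->]]|[z Rz /andP[/eqP <- /eqP <-]]].
    by exists z; rewrite /= ?eqxx.
  by exists z.
split.
- rewrite -map_comp (eq_map (g := (fun c => (rho c.1, c.2)) \o fst)) // map_comp.
  rewrite map_inj_in_uniq // => -[c o] [c' o'] Rc Rc' /= [/rho_inj Ecc' Eo].
  subst o'; case: Ecc' => [-> //|[Ec Ec']]; case: o Rc Rc' => Rc Rc'.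
  + have nu y : (y, true) \in map fst R -> y <> u by move=> + E; rewrite E (negPf uR).
    have := nu _ Rc; have := nu _ Rc'; intuition congruence.
  + have nv y : (y, false) \in map fst R -> y <> v by move=> + E; rewrite E (negPf vR).
    have := nv _ Rc; have := nv _ Rc'; intuition congruence.
- have R2 c : c <> u -> c <> v ->
      ((c, true) \in map fst R) = ((c, false) \in map fst R).
    move=> /eqP/negPf cu /eqP/negPf cv; have := T2 c.
    by rewrite /= !inE !xpair_eqE cu cv.
  have vR1 : (v, true) \in map fst R.
    have /eqP/negPf vu : v <> u by move=> E; apply: neq_uv.
    by have := T2 v; rewrite /= !inE !xpair_eqE !eqxx vu /= => ->.
  have uR1 : (u, false) \in map fst R.
    have /eqP/negPf uv := neq_uv.
    by have := T2 u; rewrite /= !inE !xpair_eqE !eqxx uv /= => <-.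
  move=> w; rewrite !memR; apply/hasP/hasP => -[[c o] Rc /= /andP[/eqP Ew /eqP Eo]];
    subst o w.
  + case: (c =P u) => [E|cu]; first by rewrite E (negPf uR) in Rc.
    case: (c =P v) => [E|cv].
      by exists (u, false); rewrite //= E rho_uv !eqxx.
    by exists (c, false); rewrite /= ?eqxx // -R2.
  + case: (c =P v) => [E|cv]; first by rewrite E (negPf vR) in Rc.
    case: (c =P u) => [E|cu].
      by exists (v, true); rewrite //= E rho_uv !eqxx.
    by exists (c, true); rewrite /= ?eqxx // R2.
- move=> w k j /mapP[[[c o] k'] Rk [-> Eo ->]] /mapP[[[c' o'] j'] Rj [Ew Eo' ->]].
  rewrite /upward /index /label /= in Eo Eo' Ew *; subst o o' => Pj.
  case/rho_inj: Ew => [E|[Ec Ec']].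
    by subst c'; apply: (T3 c k' j') => //; rewrite !inE ?Rk ?Rj !orbT.
  have {Ec} Ec : c = v by case: Ec => // Ec; rewrite Ec uRF in Rk.
  have {Ec'} Ec' : c' = u by case: Ec' => // Ec'; rewrite Ec' vRF in Rj.
  subst c c'; apply: (T3 v k' i); rewrite ?inE ?Rk ?eqxx ?orbT //.
  by apply: (T3 u i j'); rewrite ?inE ?Rj ?eqxx ?orbT.
Qed.

Lemma linked_partner u v i R : u <> v ->
    well_linked [:: (u, true, i), (v, false, i) & R] ->
  (exists k, (v, true, k) \in R) /\ (exists k, (u, false, k) \in R).
Proof.
move=> neq_uv [_ T2 _].
have mem_fst (c : nat * bool) : c \in map fst R -> exists k, (c, k) \in R.
  by case/mapP => -[c' k] Rc ->; exists k.
have /eqP/negPf uv := neq_uv.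
have /eqP/negPf vu : v <> u by move=> E; apply: neq_uv.
split; apply: mem_fst.
- by have := T2 v; rewrite /= !inE !xpair_eqE !eqxx vu /= => ->.
- by have := T2 u; rewrite /= !inE !xpair_eqE !eqxx uv /= => <-.
Qed.

(** The class of an index is its membership in [P], and [beta] is the class
   prescribed at the cut.  A strand is stray if its class is wrong in the
   orientation where this cannot be repaired: for [beta = true], a downward strand
   outside [P], as crossings involve upward strands only; for [beta = false], an
   upward strand in [P], as [P] is closed. *)
Definition stray (beta : bool) T :=
  has (fun z => (upward z == ~~ beta) && (P (index z) == ~~ beta)) T.

Arguments stray : simpl never.

Lemma strayP beta T : reflect
  (exists x i, (x, ~~ beta, i) \in T /\ P i = ~~ beta) (stray beta T).
Proof.
apply: (iffP hasP) => [[[[x o] i] Tz /andP[/eqP Eo /eqP Ei]]|[x [i [Tz Ei]]]].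
  by exists x, i; rewrite -{1}Eo.
by exists (x, ~~ beta, i); rewrite // /upward /index /= Ei !eqxx.
Qed.

Lemma stray_relabel beta rho T : stray beta (map (relabel rho) T) = stray beta T.
Proof. by rewrite /stray has_map. Qed.

Lemma stray_perm beta T T' : perm_eq T T' -> stray beta T = stray beta T'.
Proof. by move/perm_mem/eq_has_r => E; rewrite /stray E. Qed.

(** If a capped strand was stray, then so is the other end of the arc to
   which the cap joins it. *)
Lemma stray_cap beta u v i R : u <> v ->
    well_linked [:: (u, true, i), (v, false, i) & R] ->
  stray beta [:: (u, true, i), (v, false, i) & R] -> stray beta R.
Proof.
move=> neq_uv wl; have [_ _ T3] := wl.
have [[k Rk] [j Rj]] := linked_partner neq_uv wl.
have kP : P i -> P k by apply: (T3 v); rewrite !inE ?eqxx ?Rk ?orbT.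
have jP : P j -> P i by apply: (T3 u); rewrite !inE ?eqxx ?Rj ?orbT.
case/strayP => x [i' []]; rewrite !inE => /or3P[/eqP[Ex Eo ->]|/eqP[Ex Eo ->]|Rx] Pi.
- apply/strayP; exists v, k; rewrite Eo in Pi *; split=> //.
  exact: kP.
- apply/strayP; exists u, j; rewrite Eo in Pi *; split=> //.
  by apply/negbTE; apply: contraFN Pi => /jP.
- by apply/strayP; exists x, i'.
Qed.

Lemma stray_cross beta x y a b c d R : (P a -> P d) -> (P b -> P c) ->
  stray beta [:: (x, true, a), (y, true, b) & R] ->
  stray beta [:: (y, true, c), (x, true, d) & R].
Proof.
move=> Pad Pbc /strayP[w [i []]]; rewrite !inE.
move=> /or3P[/eqP[Ex Eo ->]|/eqP[Ex Eo ->]|Rx] Pi.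
- apply/strayP; exists x, d; rewrite Eo in Pi *; rewrite !inE eqxx orbT; split=> //.
  exact: Pad.
- apply/strayP; exists y, c; rewrite Eo in Pi *; rewrite !inE eqxx; split=> //.
  exact: Pbc.
- by apply/strayP; exists w, i; rewrite !inE Rx !orbT.
Qed.

Definition merge_labels (x y c : nat) : nat := if c == y then x else c.

Lemma cat2_perm (T1 T2 : seq strand) z1 z2 :
  perm_eq (T1 ++ z1 :: z2 :: T2) (z1 :: z2 :: T1 ++ T2).
Proof. by rewrite (perm_catCA T1 [:: z1; z2] T2). Qed.

Lemma merge_strands beta b x y i T1 T2 : x <> y ->
    well_linked (T1 ++ (x, b, i) :: (y, ~~ b, i) :: T2) ->
  well_linked (map (relabel (merge_labels x y)) (T1 ++ T2))
  /\ (stray beta (T1 ++ (x, b, i) :: (y, ~~ b, i) :: T2) ->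
      stray beta (map (relabel (merge_labels x y)) (T1 ++ T2))).
Proof.
move=> neq_xy wl; have neq_yx : y <> x by move=> E; apply: neq_xy.
have wl' := well_linked_perm (cat2_perm _ _ _ _) wl.
rewrite stray_relabel (stray_perm _ (cat2_perm _ _ _ _)).
have rho_id c : c <> x -> c <> y -> merge_labels x y c = c.
  by rewrite /merge_labels; case: eqP.
have rho_x : merge_labels x y x = x by rewrite /merge_labels; case: eqP.
have rho_y : merge_labels x y y = x by rewrite /merge_labels eqxx.
case: b {wl} wl' => /= wl'.
  split; last exact: stray_cap.
  by apply: well_linked_cap wl' => //; [rewrite rho_x | left].
have swap : perm_eq [:: (x, false, i), (y, true, i) & T1 ++ T2]
                    [:: (y, true, i), (x, false, i) & T1 ++ T2].
  by rewrite (perm_catCA [:: (x, false, i)] [:: (y, true, i)]).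
have {}wl' := well_linked_perm swap wl'.
rewrite (stray_perm _ swap); split; last exact: stray_cap.
by apply: well_linked_cap wl' => //; [rewrite rho_x | right | move=> c cy cx; apply: rho_id].
Qed.

Lemma cross_strands beta x y a b c d T1 T2 : (P a -> P d) -> (P b -> P c) ->
    well_linked (T1 ++ (x, true, a) :: (y, true, b) :: T2) ->
  well_linked (T1 ++ (y, true, c) :: (x, true, d) :: T2)
  /\ (stray beta (T1 ++ (x, true, a) :: (y, true, b) :: T2) ->
      stray beta (T1 ++ (y, true, c) :: (x, true, d) :: T2)).
Proof.
move=> Pad Pbc wl; have := well_linked_perm (cat2_perm _ _ _ _) wl.
rewrite !(stray_perm _ (cat2_perm _ _ _ _)) => /(well_linked_cross Pad Pbc) wl'.
split; last exact: stray_cross.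
by apply: well_linked_perm wl'; rewrite perm_sym cat2_perm.
Qed.

Lemma cup_strands f b a T1 T2 : f \notin map label (T1 ++ T2) ->
  well_linked (T1 ++ T2) -> well_linked (T1 ++ (f, b, a) :: (f, ~~ b, a) :: T2).
Proof.
move=> fT wl; apply: (@well_linked_perm ((f, b, a) :: (f, ~~ b, a) :: T1 ++ T2)).
  by rewrite perm_sym cat2_perm.
exact: well_linked_cup.
Qed.

Lemma split_strands T o1 o2 : map upward T = o1 ++ o2 ->
  exists T1 T2, [/\ T = T1 ++ T2, size T1 = size o1, map upward T1 = o1
    & map upward T2 = o2].
Proof.
move=> E; have sT : size T = (size o1 + size o2)%N by rewrite -size_cat -E size_map.
exists (take (size o1) T), (drop (size o1) T); split.
- by rewrite cat_take_drop.
- by rewrite size_takel // sT leq_addr.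
- by rewrite map_take E take_size_cat.
- by rewrite map_drop E drop_size_cat.
Qed.

Lemma split_strands2 T o1 o2 a b : map upward T = o1 ++ a :: b :: o2 ->
  exists T1 x i y j T2, [/\ T = T1 ++ (x, a, i) :: (y, b, j) :: T2,
    size T1 = size o1, map upward T1 = o1 & map upward T2 = o2].
Proof.
case/split_strands => T1 [[|[[x a'] i] [|[[y b'] j] T2]] [-> E1 E2 //= [<- <- E3]]].
by exists T1, x, i, y, j, T2.
Qed.

End StrandLists.
Arguments stray : simpl never.

Arguments components : simpl never.

(** The final cap always closes a component. *)
Lemma components_gt0 D b (T : seq (strand unit)) : well_linked predT T ->
    orientations D (map (@upward _) T) = Some [:: b; ~~ b] ->
  (0 < components (rcons D (Cap b 0)) (map (@label _) T))%N.
Proof.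
elim: D T => [|l D IH] T wl.
  case: T wl => [|[[x o] []] [|[[y o'] []] []]] // wl [Eo Eo'].
  rewrite /upward /= in Eo Eo'; subst o o'.
  rewrite /components /=; case: eqP => // neq_xy.
  have := linked_both wl x; rewrite !inE !xpair_eqE eqxx /=.
  by have /eqP/negPf -> := neq_xy; case: (b).
case/orientations_cons => o' stepl Do; move Eo: (map _ T) stepl => o stepl.
case: stepl Eo Do => [p|b'|b'] o1 o2.
- case/split_strands2 => T1 [x [[] [y [[] [T2 [ET E1 Eo1 Eo2]]]]]] Do; subst T.
  rewrite map_cat /= components_cross ?size_map //.
  have [wl' _] := @cross_strands _ predT true x y tt tt tt tt T1 T2 id id wl.
  have := IH _ wl'; rewrite !map_cat /=; apply.
  by rewrite -Do -Eo1 -Eo2.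
- case/split_strands => T1 [T2 [ET E1 Eo1 Eo2]] Do; subst T.
  rewrite map_cat /= components_cup ?size_map //=.
  set f := (foldr _ _ _).+1.
  have fT : f \notin map (@label _) (T1 ++ T2) by rewrite map_cat fresh_notin.
  have := IH _ (cup_strands b' tt fT wl); rewrite !map_cat /=; apply.
  by rewrite -Do -Eo1 -Eo2.
- case/split_strands2 => T1 [x [[] [y [[] [T2 [ET E1 Eo1 Eo2]]]]]] Do; subst T.
  rewrite map_cat /= components_cap ?size_map //; case: eqP => // neq_xy.
  have [wl' _] := merge_strands true neq_xy wl.
  have := IH _ wl'; rewrite -!map_comp -map_cat -map_comp; apply.
  by rewrite map_cat -Do -Eo1 -Eo2.
Qed.

Lemma well_linked_forget (I : finType) (P : pred I) (T : seq (strand I)) :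
  well_linked P T -> well_linked predT (map (fun z => (z.1, tt)) T).
Proof. by case=> T1 T2 T3; split; rewrite -?map_comp. Qed.

Lemma sum_image (V : nmodType) (I J : finType) (h : I -> J) (f : J -> V) :
  injective h -> (forall j, j \notin codom h -> f j = 0) ->
  \sum_j f j = \sum_i f (h i).
Proof.
move=> h_inj f0; have inj : {in predT &, injective h} by move=> x y _ _ /h_inj.
rewrite -(big_imset f inj) [RHS]big_mkcond.
apply: eq_bigr => j _; case: ifPn => // nj.
by apply: f0; apply: contra nj => /codomP[i ->]; apply: imset_f.
Qed.

Lemma strands_close (I : finType) (P : pred I) x b i j (T1 T2 : seq (strand I)) :
  well_linked P (T1 ++ (x, b, i) :: (x, ~~ b, j) :: T2) -> well_linked P (T1 ++ T2).
Proof.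
move/(well_linked_perm (cat2_perm _ _ _ _)) => [T_1 T_2 T_3].
move: T_1; rewrite /= !inE negb_or => /and3P[/andP[_ x1] x2 uT]; split=> //.
  move=> y; have := T_2 y; rewrite /= !inE !xpair_eqE.
  have [->|_] := eqVneq y x => //=.
  by clear T_2 T_3; case: b x1 x2 => /= /negPf -> /negPf ->.
by move=> y k l Tk Tl; apply: (T_3 y); rewrite !inE ?Tk ?Tl !orbT.
Qed.

(** In a knot, a cap other than the last one never closes a component, since the
   rest of the diagram closes a further one. *)
Lemma one_component_open (I : finType) (P : pred I) x b b1 i j D (T1 T2 : seq (strand I)) :
    well_linked P (T1 ++ (x, b, i) :: (x, ~~ b, j) :: T2) ->
    orientations D (map (@upward _) (T1 ++ T2)) = Some [:: b1; ~~ b1] ->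
  components (rcons D (Cap b1 0)) (map (@label _) (T1 ++ T2)) <> 0%N.
Proof.
move=> /strands_close/well_linked_forget wl Do C0.
by have := components_gt0 wl; rewrite -!map_comp => /(_ D b1 Do); rewrite C0.
Qed.

Section Transfer.
Variables (F : fieldType) (I1 I2 : finType) (w1 : weights F I1) (w2 : weights F I2).
Variables (P : pred I2) (beta : bool) (iota : I1 -> I2) (g : I1 -> F).
Hypothesis iota_inj : injective iota.
Hypothesis iota_class : forall y, P y = beta <-> y \in codom iota.
Hypothesis g_neq0 : forall a, g a != 0.
Hypothesis cross_closed : forall p a b c d,
  wcross w2 p a b c d != 0 -> (P a -> P d) /\ (P b -> P c).
Hypothesis cross_gauge : forall p a b c d,
  wcross w2 p (iota a) (iota b) (iota c) (iota d) * (g c * g d) =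
  g a * g b * wcross w1 p a b c d.
Hypothesis cup_gauge : forall b a, wcup w2 b (iota a) = wcup w1 b a.
Hypothesis cap_gauge : forall b a, wcap w2 b (iota a) = wcap w1 b a.

Definition one_component D b (l : seq nat) :=
  components (rcons D (Cap b 0)) l = 1%N.

(** A stray strand persists up to the cut, where both indices have the class
   [beta]; hence the states through it have zero weight. *)
Lemma amplitude_stray D b (t : I1) (T : seq (strand I2)) : well_linked P T ->
    orientations D (map (@upward _) T) = Some [:: b; ~~ b] ->
    one_component D b (map (@label _) T) -> stray P beta T ->
  amplitude w2 D (indicator F [:: iota t; iota t]) (map (@index _) T) = 0.
Proof.
elim: D T => [|l D IH] T wl.
  case: T wl => [|[[x o] i] [|[[y o'] j] []]] // wl _ _ st.
  rewrite /amplitude /= /indicator !eqseq_cons andbT; case: andP => // -[/eqP Ei /eqP Ej].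
  rewrite /index /= in Ei Ej; subst i j.
  have Pt : P (iota t) = beta by apply/iota_class/codom_f.
  by case/strayP: st => [z [i []]]; rewrite !inE => /orP[] /eqP[_ _ ->];
    rewrite Pt; case: (beta).
case/orientations_cons => o' stepl Do; move Eo: (map _ T) stepl => o stepl.
case: stepl Eo Do => [p|b'|b'] o1 o2.
- case/split_strands2 => T1 [x [i [y [j [T2 [ET E1 Eo1 Eo2]]]]]] Do; subst T.
  rewrite /one_component rcons_cons !map_cat /= components_cross ?size_map // => C1 st.
  rewrite layer_op_cross ?size_map // big1 // => c _; rewrite big1 // => d _.
  have [->|ne] := eqVneq (wcross w2 p i j c d) 0; first by rewrite mul0r.
  have [Pid Pjc] := cross_closed ne.
  have [wl' st'] := cross_strands beta Pid Pjc wl.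
  have := IH _ wl' _ _ (st' st); rewrite !map_cat /= => -> //; rewrite ?mulr0 //.
  by rewrite -Do -Eo1 -Eo2.
- case/split_strands => T1 [T2 [ET E1 Eo1 Eo2]] Do; subst T.
  rewrite /one_component rcons_cons !map_cat /= components_cup ?size_map //=.
  set f := (foldr _ _ _).+1 => C1 st.
  have fT : f \notin map (@label _) (T1 ++ T2) by rewrite map_cat fresh_notin.
  rewrite layer_op_cup ?size_map // big1 // => a _.
  have := IH _ (cup_strands b' a fT wl); rewrite !map_cat /= => ->; rewrite ?mulr0 //.
    by rewrite -Do -Eo1 -Eo2.
  by move: st; rewrite /stray !has_cat /= => /orP[] ->; rewrite ?orbT.
- case/split_strands2 => T1 [x [i [y [j [T2 [ET E1 Eo1 Eo2]]]]]] Do; subst T.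
  rewrite /one_component rcons_cons !map_cat /= components_cap ?size_map // => C1 st.
  rewrite layer_op_cap ?size_map // /index /=.
  have [Eij|//] := eqVneq i j; subst j.
  have [Exy|/eqP neq_xy] := eqVneq x y.
    move: C1; rewrite Exy eqxx => -[C0]; rewrite Exy in wl.
    case: (@one_component_open _ _ _ _ b _ _ D _ _ wl); last by rewrite map_cat.
    by rewrite map_cat -Do -Eo1 -Eo2.
  have [wl' st'] := merge_strands beta neq_xy wl.
  have := IH _ wl' _ _ (st' st).
  rewrite -!map_comp !map_cat => ->; rewrite ?mulr0 //.
    by rewrite -Do -Eo1 -Eo2.
  move: C1; case: eqP => // _; rewrite /one_component map_cat -!map_comp.
  exact.
Qed.

Definition lift (z : strand I1) : strand I2 := (z.1, iota (index z)).

(** Rescaling the basis vectors by [g] rescales the dual basis by its inverse. *)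
Definition gauge (T : seq (strand I1)) : F :=
  \prod_(z <- T) (if upward z then g (index z) else (g (index z))^-1).

(** At each layer, an index outside the class [beta] either has zero weight or
   creates a stray strand, so the sums over [I2] reduce to sums over the
   image of [iota]; there the weights of [w2] are those of [w1] in a rescaled
   basis. *)
Lemma amplitude_transfer D b (t : I1) (T : seq (strand I1)) :
    well_linked P (map lift T) ->
    orientations D (map (@upward _) T) = Some [:: b; ~~ b] ->
    one_component D b (map (@label _) T) ->
  amplitude w2 D (indicator F [:: iota t; iota t]) (map (iota \o @index _) T) =
  gauge T * amplitude w1 D (indicator F [:: t; t]) (map (@index _) T).
Proof.
have iota_beta a : P (iota a) = beta by apply/iota_class/codom_f.
have upward_lift T' : map (@upward _) (map lift T') = map (@upward _) T'.
  by rewrite -map_comp.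
have label_lift T' : map (@label _) (map lift T') = map (@label _) T'.
  by rewrite -map_comp.
have index_lift T' : map (@index _) (map lift T') = map (iota \o @index _) T'.
  by rewrite -map_comp.
have gauge2 T1 T2 z1 z2 : gauge (T1 ++ z1 :: z2 :: T2) =
    gauge [:: z1; z2] * gauge (T1 ++ T2).
  rewrite /gauge (perm_big _ (cat2_perm T1 T2 z1 z2)) /= !big_cons big_nil.
  by rewrite mulr1 mulrA.
elim: D T => [|l D IH] T wl.
  case: T wl => [|[[x o] i] [|[[y o'] j] []]] // _ [Eo Eo'] _.
  rewrite /upward /= in Eo Eo'; subst o o'.
  rewrite /amplitude /= /indicator !eqseq_cons !(inj_eq iota_inj) /gauge.
  rewrite !big_cons big_nil /index /upward /= !andbT; case: andP => [[/eqP -> /eqP ->]|]; last by rewrite mulr0.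
  by rewrite !mulr1; case: (b); rewrite ?divff // mulVf.
case/orientations_cons => o' stepl Do; move Eo: (map _ T) stepl => o stepl.
case: stepl Eo Do => [p|b'|b'] o1 o2.
- case/split_strands2 => T1 [x [i [y [j [T2 [ET E1 Eo1 Eo2]]]]]] Do; subst T.
  rewrite /one_component rcons_cons [map (@label _) _]map_cat /= components_cross ?size_map // => C1.
  rewrite !map_cat /= !layer_op_cross ?size_map // {2 3}/index /=.
  rewrite map_cat /= in wl.
  pose T' c d := map lift T1 ++ (y, true, c) :: (x, true, d) :: map lift T2.
  have wlT' c d : wcross w2 p (iota i) (iota j) c d != 0 -> well_linked P (T' c d).
    by move=> ne; have [Pid Pjc] := cross_closed ne; have [] := cross_strands beta Pid Pjc wl.
  have zero c d : ~~ ((c \in codom iota) && (d \in codom iota)) ->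
    wcross w2 p (iota i) (iota j) c d * amplitude w2 D (indicator F [:: iota t; iota t])
      (map (iota \o @index _) T1 ++ c :: d :: map (iota \o @index _) T2) = 0.
    have [->|ne] := eqVneq (wcross w2 p (iota i) (iota j) c d) 0; first by rewrite mul0r.
    move=> ncd; rewrite [X in _ * X](_ : _ = 0) ?mulr0 //.
    have := @amplitude_stray D b t (T' c d) (wlT' _ _ ne).
    rewrite /T' !map_cat /= !upward_lift !index_lift !label_lift; apply.
    + by rewrite -Do -Eo1 -Eo2.
    + exact: C1.
    + have [Pid Pjc] := cross_closed ne; rewrite !iota_beta in Pid Pjc.
      have {}ncd : (P c != beta) || (P d != beta).
        by move: ncd; rewrite negb_and => /orP[/negP nc|/negP nd]; apply/orP;
          [left|right]; apply/eqP => /iota_class.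
      rewrite /stray has_cat /= {1 2 3 4}/upward {1 2}/index /=.
      case: (beta) Pid Pjc ncd => [/(_ isT) Pd /(_ isT) Pc|_ _] /=.
        by rewrite Pc Pd.
      by case: (P c); case: (P d); rewrite ?orbT.
  rewrite (sum_image iota_inj) => [|c nc]; last first.
    by rewrite big1 // => d _; apply: zero; rewrite (negPf nc).
  rewrite mulr_sumr; apply: eq_bigr => c _.
  rewrite (sum_image iota_inj) => [|d nd]; last first.
    by apply: zero; rewrite (negPf nd) andbF.
  rewrite mulr_sumr; apply: eq_bigr => d _.
  have gcd_neq0 : g c * g d != 0 by rewrite mulf_neq0.
  have [cr0|ne] := eqVneq (wcross w2 p (iota i) (iota j) (iota c) (iota d)) 0.
    have /eqP := cross_gauge p i j c d; rewrite cr0 mul0r eq_sym !mulf_eq0.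
    by rewrite !(negPf (g_neq0 _)) /= => /eqP ->; rewrite !(mul0r, mulr0).
  have := IH (T1 ++ (y, true, c) :: (x, true, d) :: T2).
  rewrite !map_cat /= => ->; first last.
  + exact: C1.
  + by rewrite -Do -Eo1 -Eo2.
  + exact: wlT'.
  rewrite !gauge2 {1 3}/gauge !big_cons !big_nil /upward /index /= !mulr1.
  rewrite mulrA [X in X * _]mulrA cross_gauge.
  by ring.
- case/split_strands => T1 [T2 [ET E1 Eo1 Eo2]] Do; subst T.
  rewrite /one_component rcons_cons [map (@label _) _]map_cat /= components_cup ?size_map //=.
  set f := (foldr _ _ _).+1 => C1.
  rewrite !map_cat !layer_op_cup ?size_map //.
  rewrite map_cat in wl.
  have fT : f \notin map (@label _) (map lift T1 ++ map lift T2).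
    by rewrite map_cat !label_lift fresh_notin.
  pose T' a := map lift T1 ++ (f, b', a) :: (f, ~~ b', a) :: map lift T2.
  have wlT' a : well_linked P (T' a) by apply: cup_strands.
  rewrite (sum_image iota_inj) => [|a na]; last first.
    have := @amplitude_stray D b t (T' a) (wlT' a).
    rewrite /T' !map_cat /= !upward_lift !index_lift !label_lift => ->; rewrite ?mulr0 //.
      by rewrite -Do -Eo1 -Eo2.
    have {}na : P a != beta by apply/eqP => /iota_class; apply/negP.
    rewrite /stray has_cat /= {1 2 3 4}/upward {1 2}/index /=.
    by case: (b'); case: (beta) na; case: (P a); rewrite ?orbT.
  rewrite mulr_sumr; apply: eq_bigr => a _.
  have := IH (T1 ++ (f, b', a) :: (f, ~~ b', a) :: T2).
  rewrite !map_cat /= => ->; first last.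
  + exact: C1.
  + by rewrite -Do -Eo1 -Eo2.
  + exact: wlT'.
  rewrite gauge2 {1}/gauge !big_cons big_nil /upward /index /= cup_gauge mulr1.
  rewrite mulrCA; congr (_ * _); rewrite [X in X * gauge _](_ : _ = 1) ?mul1r //.
  by case: (b'); rewrite ?divff // mulVf.
- case/split_strands2 => T1 [x [i [y [j [T2 [ET E1 Eo1 Eo2]]]]]] Do; subst T.
  rewrite /one_component rcons_cons [map (@label _) _]map_cat /= components_cap ?size_map // => C1.
  rewrite !map_cat /= !layer_op_cap ?size_map // (inj_eq iota_inj) /index /=.
  have [Eij|_] := eqVneq i j; last by rewrite mulr0.
  subst j; rewrite map_cat /= in wl.
  have [Exy|/eqP neq_xy] := eqVneq x y.
    move: C1; rewrite Exy eqxx => -[C0]; rewrite Exy in wl.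
    case: (@one_component_open _ _ _ _ b _ _ D _ _ wl).
      by rewrite map_cat !upward_lift -Do -Eo1 -Eo2.
    by rewrite map_cat !label_lift.
  have [wl' _] := merge_strands beta neq_xy wl.
  have := IH (map (relabel (merge_labels x y)) (T1 ++ T2)).
  rewrite -!map_comp !map_cat => ->; first last.
  + move: C1; case: eqP => // _; rewrite /one_component map_cat -!map_comp.
    exact.
  + by rewrite -Do -Eo1 -Eo2.
  + by move: wl'; rewrite map_cat -!map_comp.
  rewrite gauge2 {2}/gauge !big_cons big_nil /upward /index /= cap_gauge mulr1.
  rewrite mulrCA; congr (_ * _); rewrite /gauge -map_cat big_map.
  rewrite [X in _ = X * _](_ : _ = 1) ?mul1r //.
  by case: (b'); rewrite ?divff // mulVf.
Qed.

Lemma amplitude_transfer0 D b (t : I1) :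
    orientations D [::] = Some [:: b; ~~ b] -> one_component D b [::] ->
  amplitude w2 D (indicator F [:: iota t; iota t]) [::] =
  amplitude w1 D (indicator F [:: t; t]) [::].
Proof.
move=> Do D1; have := @amplitude_transfer D b t [::] _ Do D1.
by rewrite /gauge big_nil mul1r; apply; split.
Qed.

End Transfer.

(** * Evaluation at roots of unity *)

Section OneDimensional.
Variables (F : fieldType).

(** A one-dimensional representation on which each crossing and each pivotal
   element acts by [eps]. *)
Definition line_weights (eps : F) : weights F unit :=
  @Weights F unit (fun _ _ _ _ _ => eps) (fun b _ => if b then 1 else eps)
    (fun b _ => if b then eps else 1).

Definition line_value (eps : F) b D : F :=
  (if b then 1 else eps)
  * amplitude (line_weights eps) D (indicator F [:: tt; tt]) [::].

Lemma line_value1 b D : orientations D [::] = Some [:: b; ~~ b] ->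
  line_value 1 b D = 1.
Proof.
move=> Do; suff amp1 o s : orientations D o = Some [:: b; ~~ b] ->
    size s = size o -> amplitude (line_weights 1) D (indicator F [:: tt; tt]) s = 1.
  by rewrite /line_value (amp1 [::] [::]) //; case: (b); rewrite mulr1.
elim: D o s {Do} => [|l D IH] o s.
  by move=> [->]; case: s => [|[] [|[] []]].
case/orientations_cons => o' stepl Do Es; rewrite /= -/(amplitude _ _ _).
rewrite (eq_layer_op (line_weights 1) (g := fun=> 1) stepl Es); last first.
  by move=> t Et; apply: IH Do Et.
case: stepl Es {Do} => [p|b'|b'] o1 o2 Es.
- have [s1 [a [c [s2 [-> E1 E2]]]]] := split_cat2 Es.
  rewrite layer_op_cross // (big_pred1 tt) => [|[]//].
  by rewrite (big_pred1 tt) => [|[]//]; rewrite mulr1.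
- have [s1 [s2 [-> E1 E2]]] := split_cat Es.
  by rewrite layer_op_cup // (big_pred1 tt) => [|[]//]; case: b' {Es}; rewrite mulr1.
- have [s1 [[] [[] [s2 [-> E1 E2]]]]] := split_cat2 Es.
  by rewrite layer_op_cap //; case: b' {Es}; rewrite mulr1.
Qed.

End OneDimensional.

Section RootsOfUnity.
Variables (F : fieldType) (x : F).
Hypothesis x_neq0 : x != 0.
Lemma bracket_eq0 n : (bracket x n == 0) = (x ^+ (2 * n) == 1).
Proof.
rewrite /bracket subr_eq0 mul2n -addnn exprD.
by rewrite -(inj_eq (mulIf (expf_neq0 n x_neq0))) mulVf ?expf_neq0.
Qed.

Lemma bracket_prod_last N a : (0 < a <= N)%N -> bracket x N = 0 ->
  bracket_prod x (N - a) a = 0.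
Proof.
case: a => [|a] /andP[] // _ le_aN xN; rewrite bracket_prodS.
have -> : (N - a.+1 + a).+1 = N by lia.
by rewrite xN mulr0.
Qed.

(** A strand reaches the index 0 from a nonzero index only through a power of E
   whose last factor is bracket x N. *)
Lemma crossing_closed_top N p (a b c d : 'I_N.+1) : bracket x N = 0 ->
    crossing_coef x N p a b c d != 0 ->
  (a != 0%N :> nat -> d != 0%N :> nat) /\ (b != 0%N :> nat -> c != 0%N :> nat).
Proof.
move=> xN; rewrite /crossing_coef.
have vanish (k e f : 'I_N.+1) y : k != 0%N :> nat -> e = 0%N :> nat ->
    y * (bracket_prod x (N - k) (k - e) * qbin x f (k - e)) = 0.
  move=> k0 ->; rewrite subn0 bracket_prod_last ?mul0r ?mulr0 //.
  by rewrite lt0n k0 leq_ord.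
case: p; case: ifP => [/andP[le1 /eqP E] ne|_ /eqP//].
- split=> [a0|b0]; last by apply/eqP; move/eqP: b0; lia.
  by apply/eqP => d0; move/eqP: ne; apply; apply: vanish.
- split=> [a0|b0]; first by apply/eqP; move/eqP: a0; lia.
  by apply/eqP => d0; move/eqP: ne; apply; apply: vanish.
Qed.

(* This makes [l] the multiplicative order of x^2. *)
Variable l : nat.
Hypothesis x_order : forall n, (bracket x n == 0) = (l %| n)%N.

Lemma bracket_prod_eq0 k m n : (k < n <= k + m)%N -> (l %| n)%N ->
  bracket_prod x k m = 0.
Proof.
move=> /andP[lt_kn le_nm]; rewrite -x_order => /eqP xn.
have lt_m : (n - k.+1 < m)%N by lia.
rewrite /bracket_prod (bigD1 (Ordinal lt_m)) //=.
have -> : (k + (n - k.+1)).+1 = n by lia.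
by rewrite xn mul0r.
Qed.

Lemma bracket_prod0_neq0 m : (m < l)%N -> bracket_prod x 0 m != 0.
Proof.
move=> lt_ml; apply/prodf_neq0 => j _; rewrite x_order add0n.
by apply/negP => /dvdn_leq; have := ltn_ord j; lia.
Qed.

(** The numerator of the quantum binomial contains a zero bracket, its denominator
   does not as [m < l]. *)
Lemma qbin_eq0 k m n : (k < n <= k + m)%N -> (l %| n)%N -> (m < l)%N ->
  qbin x k m = 0.
Proof.
move=> kn ln /bracket_prod0_neq0 ne; apply: (mulIf ne).
by rewrite qbin_prod // mul0r (bracket_prod_eq0 kn).
Qed.

Lemma qbin_shift k m : (m < l)%N ->
  qbin x k.+1 m * bracket x k.+1 = qbin x k m * bracket x (k + m).+1.
Proof.
move/bracket_prod0_neq0 => ne; apply: (mulIf ne).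
rewrite mulrAC qbin_prod // mulrC -bracket_prodSl bracket_prodS.
by rewrite -qbin_prod // mulrAC.
Qed.

End RootsOfUnity.

Section CutKnots.
Variables (F : fieldType) (x : F).
Hypothesis x_neq0 : x != 0.
Variables (b : bool) (D : diagram).
Hypothesis D_open : orientations D [::] = Some [:: b; ~~ b].
Hypothesis D_knot : one_component D b [::].

(** The class of the cut index consists of [a0] only, so the whole state is constant
   and the state sum is that of a one-dimensional representation. *)
Lemma open_value_line N (a0 : 'I_N.+1) (eps : F) (P : pred 'I_N.+1) beta :
    eps * eps = 1 -> x ^ wt N a0 = eps -> x ^ framed_exp N a0 a0 = eps ->
    (forall a, P a = beta <-> a = a0) ->
    (forall p (a b c d : 'I_N.+1),
      crossing_coef x N p a b c d != 0 -> (P a -> P d) /\ (P b -> P c)) ->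
  open_value x b D a0 = line_value eps b D.
Proof.
move=> eps2 wt0 fe0 Pa0 closedP.
have epsV : eps^-1 = eps.
  have eps0 : eps != 0 by apply/eqP => E; move/eqP: eps2; rewrite E mul0r eq_sym oner_eq0.
  by apply: (mulfI eps0); rewrite divff.
rewrite /open_value /line_value wt0; congr (_ * _).
apply: (@amplitude_transfer0 F unit 'I_N.+1 (line_weights eps) (rt_weights x N)
  P beta (fun=> a0) (fun=> 1) _ _ _ closedP _ _ _ D b tt D_open D_knot).
- by move=> [] [] _.
- move=> a; rewrite Pa0; split=> [->|/codomP[] //]; exact: (codom_f (fun _ : unit => a0) tt).
- by move=> ?; apply: oner_neq0.
- move=> p [] [] [] []; rewrite !mulr1 mul1r /= /crossing_coef leqnn eqxx subnn.
  rewrite bracket_prod0 qbinn0 bin_small // !expr0 !mulr1 invr1 mulr1.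
  by case: p; rewrite ?fe0 ?mulr1 // -invr_expz fe0 epsV ?mulr1.
- by move=> [] [] //=; rewrite -invr_expz wt0 epsV.
- by move=> [] [].
Qed.

Lemma open_value_top N : (x ^+ N) ^+ 2 = 1 ->
  open_value x b D (ord0 : 'I_N.+1) = line_value (x ^+ N) b D.
Proof.
move=> xN2; have xN : bracket x N = 0.
  by apply/eqP; rewrite (bracket_eq0 x_neq0) mulnC exprM xN2.
apply: (@open_value_line N ord0 (x ^+ N) (fun a => a != 0%N :> nat) false) => //.
- by rewrite exprnP; congr (x ^ _); rewrite /wt /=; lia.
- apply: (mulfI (expf_neq0 N x_neq0)); rewrite -expr2 xN2.
  rewrite exprnP -expfzDr // -[RHS](expr0z x); congr (x ^ _).
  by rewrite /framed_exp /=; lia.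
- move=> a; split=> [/negbFE/eqP a0|->] //; exact: val_inj.
- by move=> p a c d e; apply: crossing_closed_top.
Qed.

End CutKnots.

Lemma bracket_order (F : fieldType) (x : F) n : x != 0 -> (0 < n)%N ->
    bracket x n = 0 ->
  exists2 l, (0 < l <= n)%N & forall m, (bracket x m == 0) = (l %| m)%N.
Proof.
move=> x0 n_gt0 xn.
have ex : exists m, (0 < m)%N && (bracket x m == 0).
  by exists n; rewrite n_gt0 xn eqxx.
case: (ex_minnP ex) => l /andP[l_gt0 xl] l_min.
exists l; first by rewrite l_gt0 l_min // n_gt0 xn eqxx.
move=> m; apply/idP/idP => [xm|/dvdnP[k ->]].
  rewrite /dvdn -leqn0 leqNgt; apply/negP => r_gt0.
  suff /l_min : (0 < m %% l)%N && (bracket x (m %% l) == 0).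
    by rewrite leqNgt ltn_mod l_gt0.
  rewrite r_gt0 (bracket_eq0 x0); move: xm xl; rewrite !(bracket_eq0 x0).
  move=> xm /eqP xl; rewrite {1}(divn_eq m l) mulnDr exprD mulnCA mulnC exprM xl in xm.
  by rewrite expr1n mul1r in xm.
move: xl; rewrite !(bracket_eq0 x0) => /eqP xl.
by rewrite mulnCA mulnC exprM xl expr1n.
Qed.

Section SecondCase.
Variables (F : fieldType) (x : F).
Hypothesis x_neq0 : x != 0.
Variable l : nat.
Hypothesis x_order : forall n, (bracket x n == 0) = (l %| n)%N.
Notation bprod_eq0 := (bracket_prod_eq0 x_neq0 x_order).

(** (q - 1/q) E kills [v_(l-1)] by the bracket of [N + 2 - l], and F^m / [m]! does by
   the bracket of [l] as long as [0 < m < l]; for [m >= l] the accompanying E^m has [l] consecutive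
   brackets as factors. *)
Lemma crossing_closed_line N p (a b c d a0 : 'I_N.+1) :
    a0.+1 = l -> (l %| N.+2)%N -> crossing_coef x N p a b c d != 0 ->
  (a = a0 -> d = a0) /\ (b = a0 -> c = a0).
Proof.
move=> Ea0 lN.
have vanish (e f : 'I_N.+1) m y : (0 < m)%N -> e = a0 \/ f = a0 ->
    y * (bracket_prod x (N - e) m * qbin x f m) = 0.
  move=> m_gt0 [->|->].
    have lN0 : (l %| (N - a0).+1)%N.
      have -> : (N - a0).+1 = (N.+2 - l)%N by have := ltn_ord a0; lia.
      by rewrite dvdn_sub.
    by rewrite (bprod_eq0 _ lN0) ?mul0r ?mulr0 //; lia.
  case: (ltnP m l) => [lt_ml|le_lm].
    rewrite (@qbin_eq0 _ _ x_neq0 _ x_order a0 m l) ?mulr0 //; lia.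
  have l_gt0 : (0 < l)%N by rewrite -Ea0.
  rewrite (@bracket_prod_eq0 _ _ x_neq0 _ x_order _ m (((N - e) %/ l).+1 * l)) ?mul0r ?mulr0 ?dvdn_mull //.
  by rewrite ltn_ceil //= mulSn addnC leq_add // leq_trunc_div.
rewrite /crossing_coef; case: p; case: ifP => [/andP[le1 /eqP E] ne|_ /eqP//].
- split=> [Ea|Eb]; apply: val_inj => /=; apply/eqP; move: ne; apply: contraNT => ne;
    apply/eqP; apply: vanish; auto.
  + by move: le1 ne; rewrite Ea; lia.
  + by move: le1 E ne; rewrite Eb; lia.
- split=> [Ea|Eb]; apply: val_inj => /=; apply/eqP; move: ne; apply: contraNT => ne;
    apply/eqP; apply: vanish; auto.
  + by move: le1 E ne; rewrite Ea; lia.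
  + by move: le1 ne; rewrite Eb; lia.
Qed.

Lemma open_value_mid b D N (a0 : 'I_N.+1) :
    orientations D [::] = Some [:: b; ~~ b] -> one_component D b [::] ->
    a0.+1 = l -> (l %| N.+2)%N ->
  open_value x b D a0 = line_value (x ^+ N.+2) b D.
Proof.
move=> D_open D_knot Ea0 lN.
have xl : x ^+ (2 * l) = 1 by apply/eqP; rewrite -(bracket_eq0 x_neq0) x_order.
have xlz (k : int) : x ^ ((2 * l)%N%:Z * k) = 1 by rewrite -exprz_exp -exprnP xl exp1rz.
apply: (@open_value_line _ x b D D_open D_knot N a0 (x ^+ N.+2) (pred1 a0) true).
- by apply/eqP; rewrite -exprD addnn -mul2n -(bracket_eq0 x_neq0) x_order.
- rewrite -[LHS](mulr1) -(xlz 1) -expfzDr // exprnP; congr (x ^ _).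
  by rewrite /wt; lia.
(* With a0 = l - 1, the framing exponent at (a0, a0) is
     N + 2 + 2 l (l - 2 - N). *)
- rewrite -[RHS](mulr1) exprnP -(xlz (a0%:Z - 1 - N%:Z - 0)) -expfzDr //; congr (x ^ _).
  by rewrite /framed_exp -Ea0; nia.
- by move=> a; split=> [/eqP|->] //=; rewrite eqxx.
- move=> p a e c d ne; have [ad ec] := crossing_closed_line Ea0 lN ne.
  by split=> /eqP E; apply/eqP; auto.
Qed.

End SecondCase.

Section Linkage.
Variables (F : fieldType) (x : F) (N : nat).
Hypothesis x_neq0 : x != 0.
Hypothesis x_order : forall n, (bracket x n == 0) = (N.+2 %| n)%N.

Lemma bracket_small_neq0 n : (0 < n < N.+2)%N -> bracket x n != 0.
Proof.
by move=> /andP[n0 n1]; rewrite x_order; apply/negP => /dvdn_leq; lia.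
Qed.

(** The reflection responsible for the linkage between [N] and [N + 2]. *)
Lemma bracket_compl k : (k <= N.+2)%N ->
  bracket x (N.+2 - k) = - x ^+ N.+2 * bracket x k.
Proof.
move=> le_k; have /eqP : x ^+ (2 * N.+2) == 1 by rewrite -(bracket_eq0 x_neq0) x_order.
rewrite mul2n -addnn exprD => xN2.
have {}xN2 : x ^+ N.+2 = x ^- N.+2.
  by apply: (mulIf (expf_neq0 N.+2 x_neq0)); rewrite xN2 mulVf ?expf_neq0.
rewrite /bracket exprB ?unitfE // invfM invrK -xN2.
by ring.
Qed.

(** [Sym^N] is embedded in [Sym^(N+2)] as the span of the vectors of index 1 to
   [N + 1]. *)
Definition shift (a : 'I_N.+1) : 'I_N.+3 := inord a.+1.

Lemma val_shift a : shift a = a.+1 :> nat.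
Proof. by rewrite /shift inordK //; have := ltn_ord a; lia. Qed.

Lemma bracket_prod_shift a m : (a <= N)%N -> (m <= a)%N ->
  bracket_prod x (N.+2 - a.+1) m * bracket x a.+1 =
  bracket_prod x (N - a) m * bracket x (a - m).+1.
Proof.
move=> le_aN le_ma; have E0 : - x ^+ N.+2 != 0 by rewrite oppr_eq0 expf_neq0.
apply: (mulfI E0); rewrite mulrCA -bracket_compl; last lia.
rewrite [RHS]mulrCA -bracket_compl; last lia.
have -> : (N.+2 - a.+1 = (N - a).+1)%N by lia.
have -> : (N.+2 - (a - m).+1 = (N - a + m).+1)%N by lia.
by rewrite mulrC -bracket_prodSl bracket_prodS.
Qed.

Lemma expfz_link (e e' : int) : e = e' + (2 * N.+2)%N%:Z \/ e' = e + (2 * N.+2)%N%:Z ->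
  x ^ e = x ^ e'.
Proof.
have x1 : x ^ (2 * N.+2)%N%:Z = 1.
  by apply/eqP; rewrite -exprnP -(bracket_eq0 x_neq0) x_order.
by case=> ->; rewrite expfzDr // x1 mulr1.
Qed.

(** Up to the rescaling of [v_a] by the bracket of [a + 1], the R-matrix of
   [Sym^(N+2)] restricts to that of [Sym^N]; the framing exponents differ by
   2 (N + 2). *)
Lemma crossing_shift p a b c d :
    (a <= N)%N -> (b <= N)%N ->
  crossing_coef x N.+2 p a.+1 b.+1 c.+1 d.+1 * (bracket x a.+1 * bracket x b.+1) =
  bracket x c.+1 * bracket x d.+1 * crossing_coef x N p a b c d.
Proof.
move=> le_aN le_bN; rewrite /crossing_coef !ltnS !subSS !addSn !addnS !eqSS.
case: p; case: ifP => [/andP[le1 /eqP E]|]; rewrite ?mul0r ?mulr0 //.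
- rewrite (@expfz_link _ (framed_exp N c d)); last by rewrite /framed_exp; lia.
  have B := bracket_prod_shift le_aN (leq_subr d a).
  have Q : qbin x b.+1 (a - d) * bracket x b.+1 = qbin x b (a - d) * bracket x c.+1.
    rewrite (@qbin_shift _ _ x_neq0 _ x_order); last lia.
    by congr (_ * bracket _ _); lia.
  rewrite subKn // in B; rewrite subSS in B.
  rewrite -[LHS]mulrA; rewrite [X in _ * X = _](_ : _ =
    bracket_prod x (N.+1 - a) (a - d) * bracket x a.+1 *
    (qbin x b.+1 (a - d) * bracket x b.+1)); last by ring.
  by rewrite B Q; ring.
- rewrite (@expfz_link _ (- framed_exp N a b)); last by rewrite /framed_exp; lia.
  have B := bracket_prod_shift le_bN (leq_subr c b).
  have Q : qbin x a.+1 (b - c) * bracket x a.+1 = qbin x a (b - c) * bracket x d.+1.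
    rewrite (@qbin_shift _ _ x_neq0 _ x_order); last lia.
    by congr (_ * bracket _ _); lia.
  rewrite subKn // in B; rewrite subSS in B.
  rewrite -[LHS]mulrA; rewrite [X in _ * X = _](_ : _ =
    bracket_prod x (N.+1 - b) (b - c) * bracket x b.+1 *
    (qbin x a.+1 (b - c) * bracket x a.+1)); last by ring.
  by rewrite B Q; ring.
Qed.

(** E does not reach the index 0 because of the bracket of [N + 2], and F^m does
   not reach [N + 2] because the quantum binomial of [N + 2] over [m] vanishes for
   [0 < m < N + 2]. *)
Lemma crossing_closed_middle p (a b c d : 'I_N.+3) :
    crossing_coef x N.+2 p a b c d != 0 ->
  ((0 < a < N.+2)%N -> (0 < d < N.+2)%N) /\ ((0 < b < N.+2)%N -> (0 < c < N.+2)%N).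
Proof.
move=> ne; have xN : bracket x N.+2 = 0 by apply/eqP; rewrite x_order.
have [top1 top2] := crossing_closed_top x_neq0 xN ne.
have a_le := leq_ord a; have b_le := leq_ord b.
have c_le := leq_ord c; have d_le := leq_ord d.
have vanish (k m : nat) y z : (0 < k < N.+2)%N -> (k + m = N.+2)%N ->
    y * (z * qbin x k m) = 0.
  move=> k0 km; rewrite (@qbin_eq0 _ _ x_neq0 _ x_order k m N.+2) ?mulr0 //; lia.
have split_lt (k : nat) : (0 < k < N.+2)%N = (k != 0)%N && (k < N.+2)%N by rewrite lt0n.
have lt_d : (0 < a < N.+2)%N -> (d < N.+2)%N.
  move=> a0; move: ne; apply: contraNT => nd.
  rewrite /crossing_coef; case: p; case: ifP => [/andP[le1 /eqP E]|//]; first lia.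
  by apply/eqP; apply: vanish => //; lia.
have lt_c : (0 < b < N.+2)%N -> (c < N.+2)%N.
  move=> b0; move: ne; apply: contraNT => nd.
  rewrite /crossing_coef; case: p; case: ifP => [/andP[le1 /eqP E]|//]; last lia.
  by apply/eqP; apply: vanish => //; lia.
split=> k0.
- by rewrite split_lt lt_d // andbT top1 //; case/andP: k0; rewrite lt0n.
- by rewrite split_lt lt_c // andbT top2 //; case/andP: k0; rewrite lt0n.
Qed.

Lemma open_value_linkage b D (a : 'I_N.+1) :
    orientations D [::] = Some [:: b; ~~ b] -> one_component D b [::] ->
  open_value x b D (shift a) = open_value x b D a.
Proof.
move=> D_open D_knot; rewrite /open_value.
have wt_shift c : wt N.+2 (shift c) = wt N c by rewrite val_shift /wt; lia.
rewrite wt_shift; congr (_ * _).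
apply: (@amplitude_transfer0 F _ _ (rt_weights x N) (rt_weights x N.+2)
  (fun y : 'I_N.+3 => (0 < y < N.+2)%N) true shift (fun c => (bracket x c.+1)^-1)
  _ _ _ _ _ _ _ D b a D_open D_knot).
- by move=> c d /(congr1 (@nat_of_ord _)); rewrite !val_shift => -[] /val_inj.
- move=> y; split=> [y0|/codomP[c ->]]; last first.
    by rewrite val_shift ltnS; have := ltn_ord c; lia.
  have lt_y : (y.-1 < N.+1)%N by lia.
  apply/codomP; exists (Ordinal lt_y); apply: ord_inj; rewrite val_shift /=; lia.
- by move=> c; rewrite invr_neq0 // bracket_small_neq0 //; have := ltn_ord c; lia.
- by move=> p c d e f; apply: crossing_closed_middle.
- move=> p c d e f /=; rewrite !val_shift.
  have br (k : 'I_N.+1) : bracket x k.+1 != 0.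
    by rewrite bracket_small_neq0 //; have := ltn_ord k; lia.
  have := @crossing_shift p c d e f (leq_ord c) (leq_ord d).
  set A := crossing_coef _ _ _ _ _ _ _; set B := crossing_coef _ _ _ _ _ _ _.
  move=> AB; apply: (mulIf (mulf_neq0 (br c) (br d))).
  rewrite mulrAC AB; field; by rewrite !br.
- by move=> b' c /=; rewrite wt_shift.
- by move=> b' c /=; rewrite wt_shift.
Qed.

End Linkage.

Lemma laurent_eval_open (R : realType) (K : knot) N D b (a : 'I_N.+1) (z : R[i]) :
    z != 0 -> knot_word K = rcons D (Cap b 0) ->
    orientations D [::] = Some [:: b; ~~ b] ->
  laurent_eval (colored_jones N K) z = open_value z b D a.
Proof.
move=> z0 EK Do; rewrite (colored_jones_open a EK Do).
have lv : laurent_value (open_value q b D a) z (open_value z b D a).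
  apply: (laurent_valueM).
    by case: (b); [exact: laurent_value1 | exact: laurent_value_qz].
  apply: (laurent_value_amplitude z0) => t; rewrite /indicator.
  by case: eqP => _; [exact: laurent_value1 | exact: laurent_value0].
rewrite /laurent_eval; case: xgetP => [v _ lv'|/(_ _ lv)//].
exact: (laurent_value_uniq z0 lv' lv).
Qed.

Lemma expiD (R : realType) (s t : R) : expi (s + t) = expi s * expi t.
Proof.
by rewrite /expi sinD cosD; apply/eqP; rewrite eq_complex /= eqxx addrC eqxx.
Qed.

Lemma expiX (R : realType) (t : R) n : expi t ^+ n = expi (t *+ n).
Proof.
elim: n => [|n IH]; first by rewrite /expi mulr0n cos0 sin0.
by rewrite exprS IH mulrS expiD.
Qed.

Lemma expi_neq0 (R : realType) (t : R) : expi t != 0.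
Proof.
apply/eqP => E; have := expiD t (- t); rewrite E mul0r subrr /expi cos0 sin0.
by case=> /eqP; rewrite oner_eq0.
Qed.

Lemma expi_period (R : realType) (i : int) : expi (pi * i%:~R *+ 2 : R) = 1.
Proof.
have nat_period (n : nat) : expi (pi * n%:R *+ 2 : R) = 1.
  rewrite mulr_natr -mulrnA mulnC mulrnA -expiX.
  by rewrite /expi cos2pi sin2pi expr1n.
case: i => n; first exact: nat_period.
have := expiD (pi * n.+1%:R *+ 2 : R) (- (pi * n.+1%:R *+ 2)).
rewrite subrr nat_period mul1r {1}/expi cos0 sin0 NegzE mulrNz mulrN mulNrn => <-.
by [].
Qed.

Lemma expi_root (R : realType) (i : int) (n : nat) : (0 < n)%N ->
  (expi (pi * i%:~R / n%:R : R) ^+ n) ^+ 2 = 1.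
Proof.
move=> n0; rewrite -exprM expiX mulrnA -[_ / _ *+ n]mulr_natr divfK ?expi_period //.
by rewrite pnatr_eq0 -lt0n.
Qed.

(** For [N = 2] and [z = i], cutting at index 0 gives the sign [z^2 = -1], and
   cutting at index 1 gives the sign [z^4 = 1], for the same value of the
   colored Jones polynomial. *)
Lemma line_value_sign (R : realType) (K : knot) D b (eps : R[i]) :
    knot_word K = rcons D (Cap b 0) -> orientations D [::] = Some [:: b; ~~ b] ->
    one_component D b [::] -> eps ^+ 2 = 1 ->
  line_value eps b D = 1.
Proof.
move=> EK Do D1 /eqP; rewrite sqrf_eq1 => /orP[] /eqP ->; first exact: line_value1.
pose z : R[i] := 'i%C.
have z2 : z ^+ 2 = -1 by exact: sqr_i.
have z0 : z != 0 by apply: contra_eq_neq z2 => ->; rewrite expr0n eq_sym oppr_eq0 oner_eq0.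
have zb : bracket z 2 = 0 by rewrite /bracket z2 invrN invr1 subrr.
have [l l2 z_order] := bracket_order z0 (ltn0Sn 1) zb.
have El : l = 2.
  case: l l2 z_order => [|[|[|l]]] // _ /(_ 1%N); rewrite dvdnn.
  by rewrite (bracket_eq0 z0) muln1 z2 eqNr oner_eq0.
subst l.
pose one : 'I_3 := inord 1.
have top := open_value_top z0 Do D1 (N := 2) _.
have mid := @open_value_mid _ _ z0 _ z_order b D 2 one Do D1 _ _.
rewrite -z2 -top; last by rewrite z2 sqrrN expr1n.
rewrite -(laurent_eval_open _ z0 EK Do) (laurent_eval_open one z0 EK Do) mid ?inordK //.
by rewrite (exprM z 2 2) z2 sqrrN expr1n line_value1.
Qed.

Theorem theorem1p11 (R : realType) (K : knot) (N : nat) (i : int) :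
  (0 < N)%N ->
  laurent_eval (colored_jones N K) (expi (pi * i%:~R / N%:R : R)) = 1 /\
  laurent_eval (colored_jones N K) (expi (pi * i%:~R / (N + 2)%:R : R)) = 1.
Proof.
move=> N_gt0; have [D [b [EK Do D1]]] := knot_cut K.
have at_top M (z : R[i]) : z != 0 -> (z ^+ M) ^+ 2 = 1 ->
    open_value z b D (ord0 : 'I_M.+1) = 1.
  by move=> z0 zM; rewrite open_value_top // (line_value_sign EK).
split.
  set z := expi _; have z0 : z != 0 := expi_neq0 _.
  by rewrite (laurent_eval_open ord0 z0 EK Do) at_top // expi_root.
rewrite addn2; set z := expi _; have z0 : z != 0 := expi_neq0 _.
have zN : (z ^+ N.+2) ^+ 2 = 1 by rewrite expi_root.
have zb : bracket z N.+2 = 0.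
  by apply/eqP; rewrite (bracket_eq0 z0) mulnC exprM zN.
have [l /andP[l_gt0 le_l] z_order] := bracket_order z0 (ltn0Sn _) zb.
have lN : (l %| N.+2)%N by rewrite -z_order zb.
have [El|neq_l] := eqVneq l N.+2.
  subst l; rewrite (laurent_eval_open ord0 z0 EK Do).
  rewrite -(open_value_linkage z0 z_order ord0 Do D1).
  rewrite -(laurent_eval_open _ z0 EK Do) (laurent_eval_open ord0 z0 EK Do).
  exact: at_top.
have lt_l : (l.-1 < N.+1)%N by lia.
rewrite (laurent_eval_open (Ordinal lt_l) z0 EK Do).
rewrite (open_value_mid z0 z_order Do D1) //=; last by rewrite prednK.
exact: line_value_sign EK Do D1 zN.
Qed.
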